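(* Let $\alpha$ be a fixed real number with $1/3\le\alpha\le 1/2$, and let $\varepsilon=\varepsilon(n)\in(0,1)$ be a function of the positive integer $n$ such that $\varepsilon\to 0$ and $\varepsilon n^{\alpha}\to\infty$ as $n\to\infty$. For each $n$ let \[ \mathcal P=\mathcal P_n=\{(i,j)\in\mathbb N^2 : 1\le i\le n^{\alpha},\ 1\le j\le n^{1-\alpha}\}, \] and let $\mathcal L=\mathcal L_n$ be the set of all lines in $\mathbb R^2$ that contain at least $\varepsilon n^{\alpha}$ points of $\mathcal P$, are not parallel to a coordinate axis, and do not have slope $n^{1-2\alpha}$ or $-n^{1-2\alpha}$. Suppose that, as $n\to\infty$, $|\mathcal L|=o(|\mathcal P|^2)$ and $|\mathcal L|=\omega(|\mathcal P|^{2-3\alpha})$. Then, as $n\to\infty$, \[ I(\mathcal P,\mathcal L)=(c+o(1))\,|\mathcal P|^{2/3}|\mathcal L|^{2/3},\qquad\text{where } c=3\cdot\left(\frac{3}{4\pi^2}\right)^{1/3}\approx 1.27. \]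
   Context: $\mathbb N$ denotes the positive integers. For a finite set of points $\mathcal P\subset\mathbb R^2$ and a finite set of lines $\mathcal L$ in $\mathbb R^2$, $I(\mathcal P,\mathcal L)$ is the number of incidences, i.e. the number of pairs $(p,\ell)\in\mathcal P\times\mathcal L$ with $p\in\ell$. For nonnegative quantities depending on $n$, $X=o(Y)$ means $X/Y\to 0$ as $n\to\infty$, and $X=\omega(Y)$ means $X/Y\to\infty$ as $n\to\infty$; $o(1)$ denotes a quantity tending to $0$ as $n\to\infty$. *)

(* Defs.v *)
From HB Require Import structures.
From mathcomp Require Import all_boot all_order all_algebra.
From mathcomp Require Import finmap.
From mathcomp Require Import all_classical all_reals all_analysis.

Set Implicit Arguments.
Unset Strict Implicit.
Unset Printing Implicit Defensive.

Import Order.TTheory GRing.Theory Num.Theory.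
Import numFieldNormedType.Exports.

Local Open Scope classical_set_scope.
Local Open Scope ring_scope.

(* For an infinite [A] this is 0, since [fset_set A] is then empty.  The set
   [rich_lines] below is finite as soon as [1 < eps * n%:R `^ alpha], hence for
   all large [n] in the regime considered, so only the number of elements of
   finite sets enters the asymptotic statements. *)
Definition num_elts (T : choiceType) (A : set T) : nat := #|` fset_set A |.

Definition is_line (R : realType) (l : set (R * R)) : Prop :=
  exists a b c : R,
    ~ (a = 0 /\ b = 0) /\ l = [set p | a * p.1 + b * p.2 = c].

Definition vertical (R : realType) (l : set (R * R)) : Prop :=
  exists c : R, l = [set p | p.1 = c].

Definition has_slope (R : realType) (l : set (R * R)) (m : R) : Prop :=
  exists c : R, l = [set p | p.2 = m * p.1 + c].

Definition axis_parallel (R : realType) (l : set (R * R)) : Prop :=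
  vertical l \/ has_slope l 0.

Definition grid (R : realType) (alpha : R) (n : nat) : set (R * R) :=
  [set p | exists i j : nat,
     [/\ p = (i%:R, j%:R),
         (1 <= i)%N, i%:R <= n%:R `^ alpha,
         (1 <= j)%N & j%:R <= n%:R `^ (1 - alpha)]].

Definition rich_lines (R : realType) (alpha eps : R) (n : nat) :
    set (set (R * R)) :=
  [set l | [/\ is_line l,
               eps * n%:R `^ alpha <= (num_elts (grid alpha n `&` l))%:R,
               ~ axis_parallel l,
               ~ has_slope l (n%:R `^ (1 - 2 * alpha)) &
               ~ has_slope l (- n%:R `^ (1 - 2 * alpha))]].

Definition incidences (R : realType) (P : set (R * R))
    (L : set (set (R * R))) : nat :=
  num_elts [set pl : (R * R) * set (R * R) | [/\ P pl.1, L pl.2 & pl.2 pl.1]].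

Definition little_o (R : realType) (X Y : nat -> R) : Prop :=
  X n / Y n @[n --> \oo] --> (0 : R).

Definition little_omega (R : realType) (X Y : nat -> R) : Prop :=
  X n / Y n @[n --> \oo] --> +oo.

(* Main.v *)
Require Import Defs.
From HB Require Import structures.
From mathcomp Require Import all_boot all_order all_algebra.
From mathcomp Require Import finmap.
From mathcomp Require Import all_classical all_reals all_analysis.
From mathcomp Require Import ring lra zify.

Set Implicit Arguments.
Unset Strict Implicit.
Unset Printing Implicit Defensive.

Import Order.TTheory GRing.Theory Num.Theory.
Import numFieldNormedType.Exports.

Local Open Scope classical_set_scope.
Local Open Scope ring_scope.

(* A line of positive slope meeting the box [1, A] x [1, B] in more than m >= 1
   grid points has a primitive step (a, b) and a first point, and the number of
   such lines is S(m) - S(m+1), where S(m) sums (A - ma)^+ (B - mb)^+ over the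
   coprime pairs (a, b).  Summing the numbers of k-rich lines over all k, the
   incidences with these lines number m (S(m) - S(m+1)) + S(m).  Lines of
   negative slope are obtained by reflection.

   Over all pairs (a, b) the sum is explicit, T(m) ~ (AB)^2 / (4 m^2), and
   T(m) is the sum of S(dm) over d.  As 1/2^2 + 1/3^2 + ... = pi^2/6 - 1 < 1,
   this relation can be inverted by a contraction, which gives
   4 m^2 S(m) / (AB)^2 -> 6/pi^2.  As S is convex, its decrements satisfy
   4 m^3 (S(m) - S(m+1)) / (AB)^2 -> 12/pi^2.  With m the integer such that
   m < eps n^alpha <= m + 1 this gives |L| ~ (6/pi^2) (AB)^2 / m^3 and
   I ~ (9/pi^2) (AB)^2 / m^2, and m cancels in I / (|P| |L|)^(2/3).

   The value pi^2/6 comes from the sums of 1/sin^2(k pi/M) for M a power of 2,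
   which follow from 1/sin^2 x + 1/cos^2 x = 4/sin^2(2x). *)

(** * Explicit bounds on the partial sums of the inverse squares *)

Section Basel.
Variable R : realType.
Implicit Types (x : R) (M N k : nat).

Lemma sin_ltr_id x : 0 < x < pi / 2 -> sin x < x.
Proof.
case/andP=> x0 xpi.
have [c] := @MVT R sin cos 0 x x0 (fun y _ => is_derive_sin y)
  (continuous_subspaceT (@continuous_sin R)).
rewrite in_itv /= => /andP[c0 cx]; rewrite sin0 !subr0 => ->.
have pi2 : pi / 2 < pi :> R by have := @pi_gt0 R; lra.
have : cos c < cos 0 by rewrite ltr_cos // ?in_itv /=; lra.
by rewrite cos0 gtr_pMl.
Qed.

Lemma id_ltr_tan x : 0 < x < pi / 2 -> x < tan x.
Proof.
case/andP=> x0 xpi.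
have cosP (y : R) : 0 <= y <= x -> 0 < cos y.
  by move=> ?; apply: cos_gt0_pihalf; have := @pi_gt0 R; lra.
have [||c] := @MVT R tan (fun y => (cos y) ^- 2) 0 x x0.
- move=> y; rewrite in_itv /= => yx; apply: is_derive_tan.
  by rewrite gt_eqF // cosP //; lra.
- apply: continuous_in_subspaceT => y; rewrite inE /= in_itv /= => yx.
  by apply: continuous_tan; rewrite gt_eqF // cosP.
rewrite in_itv /= => /andP[c0 cx]; rewrite tan0 !subr0 => ->.
have c0' : cos c != 0 by rewrite gt_eqF // cosP //; lra.
rewrite cos2_tan2 // mulrDl mul1r ltrDl mulr_gt0 // exprn_gt0 //.
by rewrite /tan divr_gt0 ?cosP ?sin_gt0_pihalf //; lra.
Qed.

(** The lower bound comes from sin x < x, the upper one from x < tan x and 1/sin^2 x = 1/tan^2 x +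
    1. *)
Lemma csc_sqr_bounds x : 0 < x < pi / 2 ->
  x ^- 2 <= sin x ^- 2 <= x ^- 2 + 1.
Proof.
move=> xpi; have x0 : 0 < x by case/andP: xpi.
have sx : 0 < sin x by exact: sin_gt0_pihalf.
have cx : 0 < cos x by apply: cos_gt0_pihalf; have := @pi_gt0 R; lra.
apply/andP; split.
  by rewrite lef_pV2 ?posrE ?exprn_gt0 // lerXn2r ?nnegrE ?ltW ?sin_ltr_id.
have -> : sin x ^- 2 = (tan x) ^- 2 + 1.
  rewrite /tan -[LHS]mul1r -[X in X * _ = _](cos2Dsin2 x); field; rewrite !gt_eqF //.
rewrite lerD2r lef_pV2 ?posrE ?exprn_gt0 ?divr_gt0 //.
by rewrite lerXn2r ?nnegrE ?ltW ?id_ltr_tan // /tan divr_gt0.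
Qed.

Lemma csc_sqr_double x : sin (x *+ 2) != 0 ->
  sin x ^- 2 + sin (x + pi / 2) ^- 2 = 4 * sin (x *+ 2) ^- 2.
Proof.
rewrite sinDpihalf sin_mulr2n mulrn_eq0 /= mulf_eq0 negb_or => /andP[cx sx].
rewrite -mulr_natr -[RHS]mul1r -[X in _ = X * _](cos2Dsin2 x); field; exact/andP.
Qed.

Lemma big_nat_fold (f : nat -> R) M : (0 < M)%N ->
  \sum_(1 <= k < M.*2) f k =
  \sum_(1 <= k < M) f k + f M + \sum_(1 <= k < M) f (k + M)%N.
Proof.
move=> M0; rewrite (@big_cat_nat _ _ _ M) //=; last by lia.
rewrite -addrA; congr (_ + _).
rewrite big_ltn; last by lia.
by rewrite -add1n big_addn -addnn addnK.
Qed.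

Definition csc_sqr_sum M : R := \sum_(1 <= k < M) sin (k%:R * (pi / M%:R)) ^- 2.

(** The angles of k and k + M differ by pi/2, so the double-angle identity merges them into four
    times the k-th term for M; the unpaired index M contributes 1/sin^2(pi/2) = 1. *)
Lemma csc_sqr_sum_double M : (0 < M)%N ->
  csc_sqr_sum M.*2 = 4 * csc_sqr_sum M + 1.
Proof.
move=> M0; rewrite /csc_sqr_sum big_nat_fold // addrAC -big_split.
have M0' : M%:R != 0 :> R by rewrite pnatr_eq0; lia.
have half : M%:R * (pi / M.*2%:R) = pi / 2 :> R.
  by rewrite -muln2 natrM; field.
rewrite half sin_pihalf expr1n invr1; congr (_ + _).
rewrite mulr_sumr; apply: eq_big_nat => k /andP[k0 kM] /=.
rewrite (_ : (k + M)%:R * _ = k%:R * (pi / M.*2%:R) + pi / 2); last first.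
  by rewrite natrD mulrDl half.
have dbl : k%:R * (pi / M.*2%:R) *+ 2 = k%:R * (pi / M%:R) :> R.
  by rewrite -muln2 natrM -mulr_natr; field.
rewrite csc_sqr_double dbl // gt_eqF //; apply: sin_gt0_pi.
have pi0 := @pi_gt0 R; have ? : (0 : R) < M%:R by rewrite ltr0n.
apply/andP; split; first by rewrite mulr_gt0 ?divr_gt0 // ltr0n.
by rewrite mulrCA gtr_pMr // ltr_pdivrMr // mul1r ltr_nat.
Qed.

Lemma csc_sqr_sum_exp2 n : csc_sqr_sum (2 ^ n)%N = ((2 ^ n)%:R ^+ 2 - 1) / 3.
Proof.
elim: n => [|n IH]; first by rewrite /csc_sqr_sum big_geq // expr1n subrr mul0r.
by rewrite expnS mul2n csc_sqr_sum_double ?expn_gt0 // IH -muln2 natrM; field.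
Qed.

(** The reflection k -> 2M - k leaves the sine unchanged and folds the sum onto angles below pi/2,
    where the bounds on csc apply. *)
Lemma csc_sqr_half_sum M : (0 < M)%N ->
  csc_sqr_sum M.*2 =
  2 * (\sum_(1 <= k < M) sin (k%:R * (pi / M.*2%:R)) ^- 2) + 1.
Proof.
move=> M0; rewrite /csc_sqr_sum big_nat_fold // addrAC [2 * _]mulr_natl mulr2n.
have M0' : M%:R != 0 :> R by rewrite pnatr_eq0; lia.
congr (_ + _ + _); last first.
  have -> : M%:R * (pi / M.*2%:R) = pi / 2 :> R by rewrite -muln2 natrM; field.
  by rewrite sin_pihalf expr1n invr1.
rewrite big_nat_rev /=; apply: eq_big_nat => k /andP[k0 kM].
have -> : ((1 + M - k.+1 + M) = M.*2 - k)%N by lia.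
rewrite natrB; last by lia.
have -> : (M.*2%:R - k%:R) * (pi / M.*2%:R) = - (k%:R * (pi / M.*2%:R)) + pi :> R.
  by rewrite -muln2 natrM; field.
by rewrite sinDpi sinN opprK.
Qed.

Definition inv_sqr_sum N : R := \sum_(1 <= k < N.+1) k%:R ^- 2.

Lemma inv_sqr_sumS N : inv_sqr_sum N.+1 = inv_sqr_sum N + N.+1%:R ^- 2.
Proof. by rewrite /inv_sqr_sum big_nat_recr. Qed.

(* M^2 x^-2 for x = k pi / (2 M) is a multiple of k^-2, so the bounds on
   csc x turn the closed form of the csc sum into bounds on the inverse
   squares. *)
Lemma inv_sqr_sum_csc M : (0 < M)%N ->
  csc_sqr_sum M.*2 = (M.*2%:R ^+ 2 - 1) / 3 ->
  pi ^+ 2 / 6 * (1 - M%:R ^- 2) - pi ^+ 2 / 4 * M%:R ^-1 <= inv_sqr_sum M.-1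
    <= pi ^+ 2 / 6.
Proof.
move=> M0 cscE; have M0' : (0 : R) < M%:R by rewrite ltr0n.
have pi0 := @pi_gt0 R.
set H := \sum_(1 <= k < M) sin (k%:R * (pi / M.*2%:R)) ^- 2 : R.
have HE : H = 2 * (M%:R ^+ 2 - 1) / 3.
  by have := csc_sqr_half_sum M0; rewrite cscE -/H -muln2 natrM; lra.
set Z := inv_sqr_sum _.
have ZE : 4 * M%:R ^+ 2 / pi ^+ 2 * Z =
    \sum_(1 <= k < M) (k%:R * (pi / M.*2%:R)) ^- 2.
  rewrite /Z /inv_sqr_sum prednK // mulr_sumr; apply: eq_big_nat => k /andP[k0 kM].
  have k0' : (0 : R) < k%:R by rewrite ltr0n.
  rewrite -muln2 natrM; move: (@pi R) pi0 k%:R k0' M%:R M0' => p p0 x x0 y y0.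
  by field; rewrite !gt_eqF.
have bnd k : (1 <= k < M)%N -> 0 < k%:R * (@pi R / M.*2%:R) < @pi R / 2.
  case/andP=> k0 kM; have k0' : (0 : R) < k%:R by rewrite ltr0n.
  have M20 : (0 : R) < M.*2%:R by rewrite ltr0n; lia.
  apply/andP; split; first by rewrite mulr_gt0 // divr_gt0.
  rewrite (_ : k%:R * _ = pi / 2 * (k%:R / M%:R)).
    by rewrite gtr_pMr ?divr_gt0 // ltr_pdivrMr // mul1r ltr_nat.
  rewrite -muln2 natrM; move: (@pi R) k%:R M%:R M0' => p x y y0.
  by field; rewrite gt_eqF.
have ZH : 4 * M%:R ^+ 2 / pi ^+ 2 * Z <= H.
  by rewrite ZE; apply: ler_sum_nat => k /bnd /csc_sqr_bounds /andP[].
(* The upper bound on csc costs at most 1 per term, hence at most M in all. *)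
have HZ : H <= 4 * M%:R ^+ 2 / pi ^+ 2 * Z + M%:R.
  rewrite ZE; apply: (@le_trans _ _ (\sum_(1 <= k < M)
      ((k%:R * (pi / M.*2%:R)) ^- 2 + 1))).
    by apply: ler_sum_nat => k /bnd /csc_sqr_bounds /andP[].
  by rewrite big_split /= lerD2l big_const_nat iter_addr_0 ler_nat leq_subr.
have u0 : 0 < pi ^+ 2 / (4 * M%:R ^+ 2) :> R.
  by rewrite divr_gt0 ?exprn_gt0 // mulr_gt0 // exprn_gt0.
have ZE' : Z = pi ^+ 2 / (4 * M%:R ^+ 2) * (4 * M%:R ^+ 2 / pi ^+ 2 * Z).
  by move: (@pi R) pi0 M%:R M0' => p p0 y y0; field; rewrite !gt_eqF.
apply/andP; split; rewrite ZE'.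
  apply: (@le_trans _ _ (pi ^+ 2 / (4 * M%:R ^+ 2) * (H - M%:R))).
    rewrite HE le_eqVlt; apply/orP; left; apply/eqP.
    by move: (@pi R) M%:R M0' => p y y0; field; rewrite gt_eqF.
  by rewrite ler_pM2l // lerBlDr.
apply: (@le_trans _ _ (pi ^+ 2 / (4 * M%:R ^+ 2) * H)); first by rewrite ler_pM2l.
rewrite HE -subr_ge0.
have -> : pi ^+ 2 / 6 - pi ^+ 2 / (4 * M%:R ^+ 2) * (2 * (M%:R ^+ 2 - 1) / 3) =
  pi ^+ 2 / (6 * M%:R ^+ 2) :> R.
  by move: (@pi R) M%:R M0' => p y y0; field; rewrite gt_eqF.
by rewrite divr_ge0 ?exprn_ge0 ?mulr_ge0 ?exprn_ge0 ?ltW.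
Qed.

Lemma inv_sqr_sum_exp2 n (M := (2 ^ n)%N) :
  pi ^+ 2 / 6 * (1 - M%:R ^- 2) - pi ^+ 2 / 4 * M%:R ^-1 <= inv_sqr_sum M.-1
    <= pi ^+ 2 / 6.
Proof.
by apply: inv_sqr_sum_csc; rewrite ?expn_gt0 // -mul2n -expnS csc_sqr_sum_exp2.
Qed.

(** Telescoping: 1/y^2 lies between 1/y - 1/(y+1) and 1/(y-1) - 1/y. *)
Lemma inv_sqr_sum_tail N D : (0 < N)%N ->
  N.+1%:R ^-1 - (N + D).+1%:R ^-1 <= inv_sqr_sum (N + D) - inv_sqr_sum N
    <= N%:R ^-1 - (N + D)%:R ^-1.
Proof.
move=> N0; elim: D => [|D IH]; first by rewrite addn0 !subrr lexx.
rewrite addnS inv_sqr_sumS.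
have y0 : (0 : R) < (N + D)%:R by rewrite ltr0n; lia.
move: IH; rewrite -!(natr1 (N + D).+1) -!(natr1 (N + D)); set y : R := (N + D)%:R in y0 *.
have h1 : (y + 1)^-1 - (y + 1 + 1)^-1 <= (y + 1) ^- 2.
  have -> : (y + 1)^-1 - (y + 1 + 1)^-1 = ((y + 1) * (y + 2)) ^-1.
    by field; rewrite !gt_eqF //; lra.
  by rewrite lef_pV2 ?posrE; nra.
have h2 : (y + 1) ^- 2 <= y^-1 - (y + 1)^-1.
  have -> : y^-1 - (y + 1)^-1 = (y * (y + 1)) ^-1.
    by field; rewrite !gt_eqF //; lra.
  by rewrite lef_pV2 ?posrE; nra.
move: (y^-1) (y + 1)^-1 (y + 1 + 1)^-1 ((y + 1) ^- 2) h1 h2 => u v w t h1 h2.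
move: (N.+1%:R ^-1) (N%:R ^-1) (inv_sqr_sum (N + D)) (inv_sqr_sum N) => a b c d.
by case/andP=> h3 h4; apply/andP; split; lra.
Qed.

Lemma le_of_exp2 (a b : R) :
  (forall n, a <= b + (2 ^ n)%:R ^-1) -> a <= b.
Proof.
move=> ab; apply/ler_addgt0Pr => e e0.
have [n en] : exists n, e ^-1 < (2 ^ n)%:R.
  exists (Num.truncn e^-1).+1; apply: (lt_trans (truncnS_gt _)).
  by rewrite ltr_nat ltn_expl.
apply: (le_trans (ab n)); rewrite lerD2l invf_ple ?posrE ?ltW //.
Qed.

(** The csc estimate is available at 2^m - 1 only; the telescoping tail carries it down to N, with m
    so large that the error is at most 2^-n. *)
Theorem basel_bounds N : (0 < N)%N ->
  inv_sqr_sum N + N.+1%:R ^-1 <= pi ^+ 2 / 6 <= inv_sqr_sum N + N%:R ^-1.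
Proof.
move=> N0; have pi0 := @pi_gt0 R; set z := pi ^+ 2 / 6.
have z0 : 0 < z by rewrite divr_gt0 // exprn_gt0.
have pow n : (n < 2 ^ n)%N by rewrite ltn_expl.
apply/andP; split; apply: le_of_exp2 => n.
  set m := (N + n + 1)%N.
  have mM : (m <= (2 ^ m).-1)%N by have := pow m; lia.
  have /andP[_ hz] := inv_sqr_sum_exp2 m; rewrite -/z in hz.
  have /andP[h _] := inv_sqr_sum_tail (2 ^ m - N - 1) N0.
  have e1 : (N + (2 ^ m - N - 1) = (2 ^ m).-1)%N by lia.
  have e2 : ((2 ^ m).-1.+1 = 2 ^ m)%N by lia.
  rewrite e1 e2 in h.
  have lin (p q a x y w : R) : a - p <= y - x -> y <= w -> p <= q -> x + a <= w + q.
    by move=> *; lra.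
  apply: (lin _ _ _ _ _ _ h hz).
  by rewrite lef_pV2 ?posrE ?ltr0n ?expn_gt0 // ler_nat leq_exp2l //; lia.
(* [k] absorbs the constant: 4z <= k < 2^k, so 4z / 2^m <= 2^-n for the [m] below. *)
have [k kz] : exists k, 4 * z <= k%:R.
  by exists (Num.truncn (4 * z)).+1; exact: ltW (truncnS_gt _).
set m := (N + n + k + 1)%N.
have /andP[hz _] := inv_sqr_sum_exp2 m; rewrite -/z in hz.
have mM : (m <= (2 ^ m).-1)%N by have := pow m; lia.
have /andP[_ h] := inv_sqr_sum_tail (2 ^ m - N - 1) N0.
have e1 : (N + (2 ^ m - N - 1) = (2 ^ m).-1)%N by lia.
rewrite e1 in h.
have M0 : (0 : R) < (2 ^ m)%:R by rewrite ltr0n expn_gt0.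
have M1 : (2 ^ m)%:R ^- 2 <= (2 ^ m)%:R ^-1 :> R.
  rewrite lef_pV2 ?posrE ?exprn_gt0 // expr2 -natrM ler_nat.
  by rewrite leq_pmull // expn_gt0.
have z1 : z * (2 ^ m)%:R ^- 2 <= z * (2 ^ m)%:R ^-1 by rewrite ler_pM2l.
have n0 : (0 : R) < (2 ^ n)%:R by rewrite ltr0n expn_gt0.
have z4 : 4 * z * (2 ^ m)%:R ^-1 <= (2 ^ n)%:R ^-1.
  rewrite ler_pdivrMr // ler_pdivlMl // mulrC (le_trans (ler_wpM2r (ltW n0) kz)) //.
  rewrite -natrM ler_nat; apply: (@leq_trans (2 ^ k * 2 ^ n)).
    by rewrite leq_pmul2r ?expn_gt0 // ltnW.
  by rewrite -expnD leq_exp2l // /m; lia.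
have i0 : 0 <= ((2 ^ m).-1)%:R ^-1 :> R by rewrite invr_ge0.
have u0 : 0 <= z / (2 ^ m)%:R by rewrite divr_ge0 ?ltW.
have lin (w p p2 x y a b q : R) : w * (1 - p2) - 3 / 2 * w * p <= y ->
    y - x <= a - b -> w * p2 <= w * p -> 4 * w * p <= q -> 0 <= b -> 0 <= w * p ->
    w <= x + a + q by move=> *; lra.
apply: (lin _ _ _ _ _ _ _ _ _ h z1 z4 i0 u0); move: hz.
by rewrite (_ : pi ^+ 2 / 4 = 3 / 2 * z) // /z; move: (@pi R) => p; field.
Qed.

End Basel.

(** * Inversion of a Dirichlet-type relation by contraction *)

Section DirichletContraction.
Variable R : realType.

(** The bounds are 1 + 1/2 and 1 + 1/4 + 1/2; the upper one yields the contraction ratio 7/4 - 1 =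
    3/4. *)
Lemma pi2_bounds : (3 / 2 : R) <= @pi R ^+ 2 / 6 <= 7 / 4.
Proof.
have /andP[h1 _] := @basel_bounds R 1 isT.
have /andP[_ h2] := @basel_bounds R 2 isT.
move: h1 h2; rewrite !inv_sqr_sumS (_ : inv_sqr_sum R 0 = 0) ?/inv_sqr_sum ?big_geq //.
by move: (@pi R ^+ 2 / 6) => z; lra.
Qed.

Lemma inv_pi2_bounds : (0 : R) < (@pi R ^+ 2 / 6)^-1 <= 1.
Proof.
have := pi2_bounds; move: (@pi R ^+ 2 / 6) => z /andP[z1 _].
have z0 : 0 < z by lra.
by rewrite invr_gt0 z0 /= invf_le1 //; lra.
Qed.

(* The weights 1/d^2 for d > 1 have total mass pi^2/6 - 1 < 3/4, so s k is
   determined by the values s (d k), d > 1, up to a contraction. *)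
Lemma dirichlet_contraction (s : nat -> R) (N D K : nat) (eta : R) :
  (0 < D)%N -> (D <= N)%N ->
  (forall k, (0 < k)%N -> 0 <= s k <= 1) ->
  (forall k, (0 < k <= K)%N ->
     `|\sum_(1 <= d < N.+1) s (d * k)%N / d%:R ^+ 2 - 1| <= eta) ->
  forall j k, (0 < k)%N -> (k * D ^ j <= K)%N ->
    `|s k - (@pi R ^+ 2 / 6)^-1| <= (3 / 4) ^+ j + 4 * (eta + 2 / D%:R).
Proof.
move=> D0 DN s01 hT.
have := pi2_bounds; have := inv_pi2_bounds; have := @basel_bounds R N; have := @basel_bounds R D.
set z := @pi R ^+ 2 / 6; clearbody z; set w := z^-1.
move=> /(_ D0) /andP[ZD _] /(_ (leq_trans D0 DN)) /andP[ZN zN] /andP[w0 w1] /andP[z1 z2].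
have zw : z * w = 1 by rewrite mulfV // gt_eqF //; lra.
have iD : 0 < D%:R ^-1 :> R by rewrite invr_gt0 ltr0n.
have iND : N%:R ^-1 <= D%:R ^-1 :> R by rewrite lef_pV2 ?posrE ?ltr0n ?ler_nat //; lia.
have sw k : (0 < k)%N -> `|s k - w| <= 1.
  by move=> /s01 /andP[s0 s1]; rewrite ler_norml; lra.
elim=> [|j IH] k k0 kK.
  rewrite expr0 (le_trans (sw k k0)) // lerDl mulr_ge0 // addr_ge0 ?divr_ge0 //.
  by apply: le_trans (hT k _) => //; rewrite k0 /= -[k]muln1.
have kK1 : (0 < k <= K)%N.
  by rewrite k0 (leq_trans _ kK) // leq_pmulr // expn_gt0 D0.
have eta0 : 0 <= eta by apply: le_trans (hT k kK1).
set b := (3 / 4) ^+ j + 4 * (eta + 2 / D%:R) in IH.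
have b0 : 0 <= b by rewrite addr_ge0 ?exprn_ge0 ?mulr_ge0 ?addr_ge0 ?divr_ge0.
have split1 (f : nat -> R) : \sum_(1 <= d < N.+1) f d =
    f 1%N + \sum_(2 <= d < D.+1) f d + \sum_(D.+1 <= d < N.+1) f d.
  by rewrite big_ltn ?ltnS ?(leq_trans D0) // (@big_cat_nat _ _ _ D.+1) //= ?addrA //.
(* The term d = 1 is isolated. Terms with 2 <= d <= D are left to the induction, those with d > D to
   the trivial bound |s - w| <= 1, and the last summand is the truncation error of z. *)
have eqs : s k - w = (\sum_(1 <= d < N.+1) s (d * k)%N / d%:R ^+ 2 - 1)
    - (\sum_(2 <= d < D.+1) (s (d * k)%N - w) / d%:R ^+ 2
       + \sum_(D.+1 <= d < N.+1) (s (d * k)%N - w) / d%:R ^+ 2)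
    + (1 - w * inv_sqr_sum R N).
  have -> : w * inv_sqr_sum R N = \sum_(1 <= d < N.+1) w / d%:R ^+ 2.
    by rewrite mulr_sumr.
  rewrite !split1 mul1n expr1n !divr1.
  have sumB m n : \sum_(m <= d < n) (s (d * k)%N - w) / d%:R ^+ 2 =
    \sum_(m <= d < n) s (d * k)%N / d%:R ^+ 2 - \sum_(m <= d < n) w / d%:R ^+ 2.
    by rewrite -sumrB; apply: eq_bigr => d _; rewrite mulrBl.
  by rewrite !sumB; ring.
have hA := hT k kK1.
have hC : `|1 - w * inv_sqr_sum R N| <= D%:R ^-1.
  have ZN' : inv_sqr_sum R N <= z by apply: le_trans ZN; rewrite lerDl invr_ge0.
  have -> : 1 - w * inv_sqr_sum R N = w * (z - inv_sqr_sum R N).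
    by rewrite mulrBr [w * z]mulrC zw.
  rewrite ger0_norm ?mulr_ge0 ?subr_ge0 ?(ltW w0) //.
  rewrite (le_trans _ iND) // (@le_trans _ _ (z - inv_sqr_sum R N)) //; last by lra.
  by rewrite ler_piMl // subr_ge0.
have normdiv d x : `|x / d%:R ^+ 2| = `|x| / d%:R ^+ 2 :> R.
  by rewrite normf_div [X in _ / X]ger0_norm // exprn_ge0.
have hB1 : `|\sum_(2 <= d < D.+1) (s (d * k)%N - w) / d%:R ^+ 2| <= 3 / 4 * b.
  apply: (le_trans (ler_norm_sum _ _ _)).
  apply: (@le_trans _ _ (\sum_(2 <= d < D.+1) b * d%:R ^- 2)).
    apply: ler_sum_nat => d /andP[d2 dD]; rewrite normdiv ler_wpM2r ?invr_ge0 ?exprn_ge0 //.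
    (* The induction hypothesis reaches d k, as d k D^j <= k D^(j+1) <= K. *)
    apply: IH; first by rewrite muln_gt0 k0 andbT; exact: ltnW.
    rewrite (leq_trans _ kK) // expnS mulnA leq_mul2r; apply/orP; right.
    by rewrite mulnC leq_mul2l -ltnS dD orbT.
  rewrite -mulr_sumr mulrC ler_wpM2r //.
  have : inv_sqr_sum R D = 1 + \sum_(2 <= d < D.+1) d%:R ^- 2.
    by rewrite /inv_sqr_sum big_ltn // expr1n invr1.
  move: ZD (\sum_(2 <= d < _) _); move: (inv_sqr_sum R D) => Z ZD Y ZE.
  by have : 0 <= D.+1%:R ^-1 :> R by []; move: ZD; move: D.+1%:R^-1 => i *; lra.
have hB2 : `|\sum_(D.+1 <= d < N.+1) (s (d * k)%N - w) / d%:R ^+ 2| <= D%:R ^-1.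
  apply: (le_trans (ler_norm_sum _ _ _)).
  apply: (@le_trans _ _ (\sum_(D.+1 <= d < N.+1) d%:R ^- 2)).
    apply: ler_sum_nat => d /andP[d2 dD].
    rewrite normdiv -[leRHS]mul1r ler_wpM2r ?invr_ge0 ?exprn_ge0 //.
    by apply: sw; rewrite muln_gt0 k0 andbT; exact: leq_ltn_trans d2.
  have /andP[_ h] := inv_sqr_sum_tail R (N - D) D0.
  rewrite subnKC // in h; have : 0 <= N%:R ^-1 :> R by rewrite invr_ge0.
  have -> : \sum_(D.+1 <= d < N.+1) d%:R ^- 2 = inv_sqr_sum R N - inv_sqr_sum R D.
    by rewrite /inv_sqr_sum (@big_cat_nat _ _ _ D.+1 1 N.+1) //= addrAC subrr add0r.
  by move: h; move: (inv_sqr_sum R N - inv_sqr_sum R D) D%:R^-1 N%:R^-1 => *; lra.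
(* The bound reproduces itself because 3/4 * 4 + 1 = 4. *)
rewrite eqs exprSr; move: hA hB1 hB2 hC.
set X := _ - 1; set Y1 := \sum_(2 <= d < _) _; set Y2 := \sum_(D.+1 <= d < _) _.
set V := 1 - _ * _; move=> hA hB1 hB2 hC.
have : `|X - (Y1 + Y2) + V| <= `|X| + (`|Y1| + `|Y2|) + `|V|.
  apply: (le_trans (ler_normD _ _)); rewrite lerD2r.
  by apply: (le_trans (ler_normB _ _)); rewrite lerD2l ler_normD.
move: hA hB1 hB2 hC; rewrite /b; move: `|_ + V| `|X| `|Y1| `|Y2| `|V| ((3 / 4) ^+ j).
by move: (D%:R^-1) => i *; lra.
Qed.

End DirichletContraction.

(** * Lattice runs and their sums over steps *)

Section Runs.
Local Open Scope nat_scope.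

(* The number of grid points (i, j), 0 <= i < A, 0 <= j < B, for which
   (i + m a, j + m b) is again a grid point. *)
Definition runs (A B a b m : nat) : nat := (A - m * a) * (B - m * b).

(** [P] selects the admissible steps. Truncated subtraction supplies the positive parts, so for m >
    0 steps with a > A or b > B would contribute 0. *)
Definition sum_runs (P : nat -> nat -> bool) (A B m : nat) : nat :=
  \sum_(1 <= a < A.+1) \sum_(1 <= b < B.+1 | P a b) runs A B a b m.

Lemma leq_runs A B a b m : runs A B a b m.+1 <= runs A B a b m.
Proof. by rewrite /runs leq_mul ?leq_sub2l ?leq_mul2r ?leqnSn ?orbT. Qed.

Lemma runs_le A B a b m : runs A B a b m <= A * B.
Proof. by rewrite leq_mul ?leq_subr. Qed.

(** A product of nonnegative, nonincreasing convex sequences is convex. *)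
Lemma runs_convex A B a b m :
  2 * runs A B a b m.+1 <= runs A B a b m + runs A B a b m.+2.
Proof.
rewrite /runs !mulSn.
(* Writing three consecutive values as x, x + p, x + 2p + q encodes monotonicity and convexity and
   removes truncated subtraction. *)
have shape (X c : nat) : exists x p q,
    [/\ X - (c + (c + m * c)) = x, X - (c + m * c) = x + p &
         X - m * c = x + p + p + q].
  move: (m * c) => y.
  by exists (X - (c + (c + y))), (X - (c + y) - (X - (c + (c + y)))),
    (X - y + (X - (c + (c + y))) - 2 * (X - (c + y))); split; lia.
have [x [p [q [-> -> ->]]]] := shape A a.
by have [y [r [t [-> -> ->]]]] := shape B b; nia.
Qed.

Lemma leq_sum_runs P A B m : sum_runs P A B m.+1 <= sum_runs P A B m.
Proof. by apply: leq_sum => a _; apply: leq_sum => b _; exact: leq_runs. Qed.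

Lemma sum_runs_convex P A B m :
  2 * sum_runs P A B m.+1 <= sum_runs P A B m + sum_runs P A B m.+2.
Proof.
rewrite /sum_runs -big_split /= big_distrr /=; apply: leq_sum => a _.
rewrite -big_split /= big_distrr /=; apply: leq_sum => b _.
exact: runs_convex.
Qed.

Lemma sum_runs_eq0 P A B m : A <= m -> sum_runs P A B m = 0.
Proof.
move=> Am; rewrite /sum_runs big1_seq // => a /andP[_]; rewrite mem_index_iota => ha.
rewrite big1 // => b _; rewrite /runs (_ : A - m * a = 0) //.
by apply/eqP; rewrite subn_eq0 (leq_trans Am) // leq_pmulr //; lia.
Qed.

Lemma sum_runs_all A B m : sum_runs (fun _ _ => true) A B m =
  (\sum_(1 <= a < A.+1) (A - m * a)) * (\sum_(1 <= b < B.+1) (B - m * b)).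
Proof. by rewrite big_distrlr. Qed.

(** As [h] vanishes beyond n, the range may first be enlarged to [1, d n], whose multiples of d are
    d, 2d, ..., n d. *)
Lemma big_dvdn_nat (h : nat -> nat) d n : 0 < d -> (forall a, n < a -> h a = 0) ->
  \sum_(1 <= a < n.+1 | d %| a) h a = \sum_(1 <= a < n.+1) h (d * a).
Proof.
move=> d0 h0; transitivity (\sum_(1 <= a < (d * n).+1 | d %| a) h a).
  rewrite (@big_cat_nat _ _ _ n.+1 1 (d * n).+1) //=; last by rewrite ltnS leq_pmull.
  rewrite [X in _ = _ + X]big1_seq ?addn0 // => a; rewrite mem_index_iota.
  by case/andP=> _ /andP[an _]; exact: h0.
elim: n {h0} => [|n IH]; first by rewrite muln0 !big_geq.
rewrite [RHS]big_nat_recr //= -IH (@big_cat_nat _ _ _ (d * n).+1) //=; last first.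
  by rewrite ltnS leq_pmul2l.
congr addn; rewrite big_mkcond mulnS addnC big_nat_recr /=; last by lia.
rewrite big1_seq ?add0n.
  by rewrite addnC -mulnS dvdn_mulr.
move=> a; rewrite mem_index_iota => /andP[_ ha]; case: ifP => // /dvdnP[q aE].
move: ha; rewrite aE; have [qn|qn] := leqP q n.
  by have := leq_mul qn (leqnn d); lia.
by have := leq_mul qn (leqnn d); lia.
Qed.

(** Steps are grouped by their gcd d: m steps (d a, d b) amount to d m steps (a, b) with (a, b)
    coprime. *)
Lemma sum_runs_coprime A B m : 0 < m ->
  sum_runs (fun _ _ => true) A B m =
  \sum_(1 <= d < A.+1) sum_runs coprime A B (d * m).
Proof.
move=> m0.
transitivity (\sum_(1 <= d < A.+1) \sum_(1 <= a < A.+1) \sum_(1 <= b < B.+1)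
    (if gcdn a b == d then runs A B a b m else 0)).
  rewrite exchange_big /=; apply: eq_big_nat => a ha.
  rewrite exchange_big /=; apply: eq_big_nat => b hb.
  rewrite (bigD1_seq (gcdn a b)) ?iota_uniq //=.
    rewrite eqxx big1 ?addn0 // => d /negbTE; by rewrite eq_sym => ->.
  rewrite mem_index_iota gcdn_gt0 (_ : 0 < a) /=; last by lia.
  by rewrite ltnS (leq_trans (dvdn_leq _ (dvdn_gcdl _ _))) //; lia.
apply: eq_big_nat => d /andP[d0 _].
have vanA a b : A < a -> runs A B a b m = 0.
  move=> Aa; rewrite /runs (_ : A - m * a = 0) //.
  by apply/eqP; rewrite subn_eq0 (leq_trans (ltnW Aa)) // leq_pmull.
have vanB a b : B < b -> runs A B a b m = 0.
  move=> Bb; rewrite /runs (_ : B - m * b = 0) ?muln0 //.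
  by apply/eqP; rewrite subn_eq0 (leq_trans (ltnW Bb)) // leq_pmull.
transitivity (\sum_(1 <= a < A.+1 | d %| a) \sum_(1 <= b < B.+1 | d %| b)
    (if gcdn a b == d then runs A B a b m else 0)).
  rewrite [RHS]big_mkcond /=; apply: eq_bigr => a _.
  case: (boolP (d %| a)) => [_|da].
    rewrite [RHS]big_mkcond /=; apply: eq_bigr => b _.
    case: (boolP (d %| b)) => // db; case: (gcdn a b =P d) => // gd.
    by rewrite -gd dvdn_gcdr in db.
  rewrite big1 // => b _; case: (gcdn a b =P d) => // gd.
  by rewrite -gd dvdn_gcdl in da.
rewrite big_dvdn_nat //; last first.
  by move=> a Aa; rewrite big1 // => b _; case: ifP => // _; exact: vanA.
apply: eq_bigr => a _; rewrite big_dvdn_nat //; last first.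
  by move=> b Bb; case: ifP => // _; exact: vanB.
rewrite [RHS]big_mkcond /=; apply: eq_bigr => b _.
rewrite -muln_gcdr -{2}[d]muln1 eqn_pmul2l // /runs.
by rewrite ![m * (d * _)]mulnA ![m * d]mulnC.
Qed.

(** Discrete integration of A - k t: consecutive terms x >= y satisfy 2 k y <= x^2 - y^2 <= 2 k x,
    even when truncated at 0, and the squares telescope. *)
Lemma sum_progression_bounds A k : 0 < k ->
  2 * k * (\sum_(1 <= a < A.+1) (A - k * a)) <= A ^ 2
    <= 2 * k * (\sum_(1 <= a < A.+1) (A - k * a)) + 2 * k * A.
Proof.
move=> k0; have step n : let x := A - k * n in let y := A - k * n.+1 in
    2 * k * y + y ^ 2 <= x ^ 2 <= 2 * k * x + y ^ 2.
  rewrite /= mulnS; move: (k * n) => u; have [h|h] := leqP (k + u) A.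
    by rewrite (_ : A - u = A - (k + u) + k); [move: (A - (k + u)) => v; nia | lia].
  rewrite (_ : A - (k + u) = 0); last by lia.
  have : A - u < k by lia.
  by move: (A - u) => v; nia.
have up n : 2 * k * (\sum_(1 <= a < n.+1) (A - k * a)) + (A - k * n) ^ 2 <= A ^ 2.
  elim: n => [|n IH]; first by rewrite big_geq // !muln0 subn0.
  by rewrite big_nat_recr //= mulnDr; have /andP[h _] := step n; lia.
(* This sum starts at 0; its extra term A is the source of 2 k A. *)
have lo n : A ^ 2 <= 2 * k * (\sum_(0 <= a < n) (A - k * a)) + (A - k * n) ^ 2.
  elim: n => [|n IH]; first by rewrite big_geq // !muln0 subn0.
  by rewrite big_nat_recr //= mulnDr; have /andP[_ h] := step n; lia.
apply/andP; split; first by have := up A; lia.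
have z : A - k * A.+1 = 0 by apply/eqP; rewrite subn_eq0; nia.
by have := lo A.+1; rewrite z addn0 big_ltn // muln0 subn0 mulnDr addnC.
Qed.

End Runs.

(** * Limiting density of runs over coprime steps *)

Section RunDensity.
Variable R : realType.
Implicit Types A B k : nat.

(* Normalised so that the full sum over all steps (a, b) has density 1. *)
Definition run_density A B k : R :=
  4 * k%:R ^+ 2 * (sum_runs coprime A B k)%:R / (A%:R * B%:R) ^+ 2.

Lemma sum_progression_ratio A k : (0 < A)%N -> (0 < k)%N ->
  1 - 2 * k%:R / A%:R <=
    (2 * k%:R * (\sum_(1 <= a < A.+1) (A - k * a))%N%:R / A%:R ^+ 2 : R) <= 1.
Proof.
move=> A0 k0; have A0' : (0 : R) < A%:R by rewrite ltr0n.
have /andP[] := sum_progression_bounds A k0.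
move: (\sum_(1 <= a < A.+1) _)%N => F up lo; move: up lo.
rewrite -!(ler_nat R) !natrX !natrD !natrM => up lo.
rewrite ler_pdivrMr ?exprn_gt0 // mul1r up andbT ler_pdivlMr ?exprn_gt0 //.
rewrite (_ : (1 - _) * _ = A%:R ^+ 2 - 2 * k%:R * A%:R); last first.
  by field; rewrite gt_eqF.
by rewrite lerBlDr.
Qed.

(** The coprime sum is at most the full sum, whose density is a product of two ratios at most 1. The
    contraction needs this a priori bound. *)
Lemma run_density_ge0_le1 A B k : (0 < A)%N -> (0 < B)%N -> (0 < k)%N ->
  0 <= run_density A B k <= 1.
Proof.
move=> A0 B0 k0; have A0' : (0 : R) < A%:R by rewrite ltr0n.
have B0' : (0 : R) < B%:R by rewrite ltr0n.
rewrite divr_ge0 ?mulr_ge0 ?exprn_ge0 //=.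
have : (sum_runs coprime A B k <= sum_runs (fun _ _ => true) A B k)%N.
  apply: leq_sum => a _; rewrite big_mkcond; apply: leq_sum => b _.
  by case: ifP.
rewrite sum_runs_all -(ler_nat R) natrM.
have /andP[_] := sum_progression_ratio A0 k0.
have /andP[_] := sum_progression_ratio B0 k0.
rewrite !ler_pdivrMr ?exprn_gt0 ?mulr_gt0 // !mul1r.
move=> hB hA hS.
rewrite exprMn (le_trans _ (ler_pM _ _ hA hB)) ?mulr_ge0 //.
rewrite mulrACA [4 * _](_ : _ = 2 * k%:R * (2 * k%:R)); last by ring.
by rewrite ler_wpM2l ?mulr_ge0.
Qed.

(** The factor (d k)^2 in the density cancels 1/d^2, so the sum is the density over all steps: a
    product of two ratios that fall short of 1 by at most 2k/A and 2k/B. *)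
Lemma sum_run_density A B k : (0 < A)%N -> (0 < B)%N -> (0 < k)%N ->
  `|\sum_(1 <= d < A.+1) run_density A B (d * k) / d%:R ^+ 2 - 1|
    <= 2 * k%:R / A%:R + 2 * k%:R / B%:R.
Proof.
move=> A0 B0 k0; have A0' : (0 : R) < A%:R by rewrite ltr0n.
have B0' : (0 : R) < B%:R by rewrite ltr0n.
have -> : \sum_(1 <= d < A.+1) run_density A B (d * k) / d%:R ^+ 2 =
    (2 * k%:R * (\sum_(1 <= a < A.+1) (A - k * a))%N%:R / A%:R ^+ 2) *
    (2 * k%:R * (\sum_(1 <= b < B.+1) (B - k * b))%N%:R / B%:R ^+ 2).
  transitivity (4 * k%:R ^+ 2 / (A%:R * B%:R) ^+ 2 *
      (sum_runs (fun _ _ => true) A B k)%:R : R).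
    rewrite sum_runs_coprime // natr_sum mulr_sumr; apply: eq_big_nat => d /andP[d0 _].
    have d0' : (0 : R) < d%:R by rewrite ltr0n.
    by rewrite /run_density natrM; field; rewrite !gt_eqF.
  by rewrite sum_runs_all natrM; field; rewrite !gt_eqF.
have := sum_progression_ratio A0 k0; have := sum_progression_ratio B0 k0.
have x0 : 0 <= 2 * k%:R * (\sum_(1 <= a < A.+1) (A - k * a))%N%:R / A%:R ^+ 2 :> R.
  by rewrite divr_ge0 ?mulr_ge0 ?exprn_ge0.
move: x0; move: (_ / A%:R ^+ 2) (_ / B%:R ^+ 2) => x y x0.
move: (2 * k%:R / A%:R) (2 * k%:R / B%:R) => a b /andP[yl yu] /andP[xl xu].
rewrite ler0_norm; last by rewrite subr_le0; nra.
by nra.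
Qed.

(** Order of choices: j for the contraction, D for the tail, then kappa so small that all indices up
    to k D^j remain small against A and B. *)
Lemma run_density_limit (e : R) : 0 < e -> exists2 kappa : R, 0 < kappa &
  forall A B k, (0 < k)%N -> k%:R <= kappa * A%:R -> k%:R <= kappa * B%:R ->
    `|run_density A B k - (pi ^+ 2 / 6)^-1| <= e.
Proof.
move=> e0; have e3 : 0 < e / 3 by rewrite divr_gt0.
have [j je] : exists j : nat, (3 / 4 : R) ^+ j < e / 3.
  have : `|3 / 4 : R| < 1 by rewrite ger0_norm; lra.
  move=> /cvg_expr /cvgrPdist_lt /(_ _ e3) [j _ /(_ j (leqnn j))].
  by rewrite sub0r normrN ger0_norm ?exprn_ge0 //; exists j.
have [D D0 De] : exists2 D, (0 < D)%N & 8 / D%:R <= e / 3.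
  exists (Num.truncn (24 / e)).+1 => //.
  rewrite ler_pdivrMr ?ltr0n // mulrC -ler_pdivrMr //.
  by apply: le_trans (ltW (truncnS_gt _)); rewrite le_eqVlt; apply/orP; left; apply/eqP;
    field; rewrite gt_eqF.
have D0' : (0 : R) < D%:R by rewrite ltr0n.
have Dj0 : 0 < (D ^ j)%:R :> R by rewrite ltr0n expn_gt0 D0.
(* The first bound forces D <= A, the second 4 eta <= e/3. *)
pose kappa := Num.min (D%:R ^-1) (e / (48 * (D ^ j)%:R)).
have kap0 : 0 < kappa.
  by rewrite /kappa lt_min invr_gt0 D0' divr_gt0 // mulr_gt0.
have kapD : kappa * D%:R <= 1.
  by rewrite -ler_pdivlMr // mul1r /kappa ge_min lexx.
have kapDj : kappa * (48 * (D ^ j)%:R) <= e.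
  by rewrite -ler_pdivlMr ?mulr_gt0 // /kappa ge_min lexx orbT.
clearbody kappa; exists kappa => // A B k k0 kA kB.
have k0' : (1 : R) <= k%:R by rewrite ler1n.
have DA : (D <= A)%N.
  rewrite -(ler_nat R) -(ler_pM2l kap0); apply: le_trans kA.
  exact: le_trans kapD k0'.
have A0 : (0 < A)%N by exact: leq_trans DA.
have B0' : (0 : R) < B%:R.
  by rewrite -(pmulr_rgt0 _ kap0); apply: lt_le_trans kB; apply: lt_le_trans k0'.
have B0 : (0 < B)%N by rewrite -(ltr0n R).
have A0' : (0 : R) < A%:R by rewrite ltr0n.
pose K := (k * D ^ j)%N; pose eta : R := 2 * K%:R / A%:R + 2 * K%:R / B%:R.
have etae : 4 * eta <= e / 3.
  have small X : (0 : R) < X%:R -> k%:R <= kappa * X%:R -> 24 * (2 * K%:R / X%:R) <= e.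
    move=> X0 kX; apply: le_trans kapDj; rewrite mulrA ler_pdivrMr // /K natrM.
    have : k%:R * (D ^ j)%:R <= kappa * X%:R * (D ^ j)%:R by rewrite ler_pM2r.
    by move: (D ^ j)%:R => q; lra.
  by have := small A A0' kA; have := small B B0' kB; rewrite /eta; lra.
have := @dirichlet_contraction R (run_density A B) A D K eta D0 DA.
move=> /(_ _ _ j k k0 (leqnn K)) H; apply: (le_trans (H _ _)).
- by move=> i; exact: run_density_ge0_le1.
- move=> i /andP[i0 iK]; apply: (le_trans (sum_run_density A0 B0 i0)).
  by rewrite lerD // ler_pM2r ?invr_gt0 // ler_pM2l // ler_nat.
- by rewrite mulrDr mulrA; have := De; move: (8 / D%:R) => q; lra.
Qed.

End RunDensity.

(** * From convex sequences to their decrements *)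

Section Tauberian.
Variable R : realType.
Implicit Types (u : nat -> R) (k h : nat).

Definition convex_seq u := forall k, 2 * u k.+1 <= u k + u k.+2.

Lemma convex_seq_decr u k h : convex_seq u ->
  u (k + h)%N - u (k + h).+1 <= u k - u k.+1.
Proof.
move=> cu; elim: h => [|h IH]; first by rewrite addn0.
by apply: le_trans IH; rewrite addnS; have := cu (k + h)%N; lra.
Qed.

(** The middle term is a sum of h decrements, which are nonincreasing by convexity. *)
Lemma convex_seq_sub u k h : convex_seq u ->
  h%:R * (u (k + h)%N - u (k + h).+1) <= u k - u (k + h)%N <= h%:R * (u k - u k.+1).
Proof.
move=> cu; elim: h => [|h /andP[IH1 IH2]]; first by rewrite addn0 !mul0r subrr lexx.
have d1 := cu (k + h)%N; have d2 := convex_seq_decr k h cu.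
have h0 : (0 : R) <= h%:R by [].
rewrite addnS -natr1; move: d1 d2 IH1 IH2 h0.
move: (u k) (u k.+1) (u (k + h)%N) (u (k + h).+1) (u (k + h).+2) h%:R => a b c d f x.
by move=> *; apply/andP; split; nra.
Qed.

(* x = h / k; a, b, c are the values k^2 u(k - h), k^2 u(k), k^2 u(k + h). *)
Lemma decrement_upper (x w e a b D : R) : 0 < x -> x <= 1 / 2 -> 0 <= w <= 1 -> 0 <= e ->
  (1 - x) ^+ 2 * a <= w + e -> w - e <= b -> x * D <= a - b ->
  D <= 2 * w + 12 * x + 6 * e / x.
Proof.
move=> x0 x1 /andP[w0 w1] e0 ha hb hD.
(* The quadratic dominates (1 - x)^-2 for 0 < x <= 1/2. *)
have a1 : a <= (w + e) * (1 + 2 * x + 12 * x ^+ 2).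
  have P1 : 1 <= (1 - x) ^+ 2 * (1 + 2 * x + 12 * x ^+ 2).
    rewrite -subr_ge0 (_ : _ - 1 = x ^+ 2 * (9 - 22 * x + 12 * x ^+ 2)); last by ring.
    by rewrite mulr_ge0 ?exprn_ge0 ?ltW //; nra.
  have q0 : 0 < (1 - x) ^+ 2 by rewrite exprn_gt0 // subr_gt0; lra.
  rewrite -(ler_pM2l q0) (le_trans ha) // mulrCA ler_peMr // addr_ge0 //.
have x2 : x ^+ 2 <= 1 / 4 by nra.
rewrite -(ler_pM2l x0) (_ : x * (_ + 6 * e / x) = 2 * w * x + 12 * x ^+ 2 + 6 * e).
  by apply: (le_trans hD); nra.
by field; rewrite gt_eqF.
Qed.

Lemma decrement_lower (x w e b c D : R) : 0 < x -> x <= 1 / 2 -> 0 <= w <= 1 -> 0 <= e ->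
  (1 + x) ^+ 2 * c <= w + e -> w - e <= b -> b - c <= x * D ->
  2 * w - 3 * x - 3 * e / x <= D.
Proof.
move=> x0 x1 /andP[w0 w1] e0 hc hb hD.
(* Likewise the quadratic dominates (1 + x)^-2. *)
have c1 : c <= (w + e) * (1 - 2 * x + 3 * x ^+ 2).
  have P1 : 1 <= (1 + x) ^+ 2 * (1 - 2 * x + 3 * x ^+ 2).
    rewrite -subr_ge0 (_ : _ - 1 = x ^+ 3 * (4 + 3 * x)); last by ring.
    by rewrite mulr_ge0 ?exprn_ge0 ?ltW //; nra.
  have q0 : 0 < (1 + x) ^+ 2 by rewrite exprn_gt0 //; lra.
  rewrite -(ler_pM2l q0) (le_trans hc) // mulrCA ler_peMr // addr_ge0 //.
have x2 : x ^+ 2 <= x / 2 by nra.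
rewrite -(ler_pM2l x0) (_ : x * (_ - 3 * e / x) = 2 * w * x - 3 * x ^+ 2 - 3 * e).
  by apply: le_trans hD; nra.
by field; rewrite gt_eqF.
Qed.

(* Tauberian step: convexity traps the decrement at k between the difference
   quotients of u over steps of length h = k / p on either side of k. *)
Lemma convex_seq_decrement u (w e : R) (p k : nat) :
  convex_seq u -> 0 <= w <= 1 -> 0 <= e -> (1 < p)%N -> (p <= k)%N ->
  (forall i, (0 < i <= 2 * k)%N -> `|i%:R ^+ 2 * u i - w| <= e) ->
  `|k%:R ^+ 3 * (u k - u k.+1) - 2 * w| <= 12 / p%:R + 12 * p%:R * e.
Proof.
move=> cu w01 e0 p1 pk hu; have [h [h0 hpk khp]] : exists h,
    [/\ (0 < h)%N, (h * p <= k)%N & (k <= 2 * (h * p))%N].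
  (* Rounding k / p down keeps h / k between 1/(2p) and 1/p. *)
  exists (k %/ p)%N; have p0 := ltnW p1; have h0 : (0 < k %/ p)%N by rewrite divn_gt0.
  have := leq_trunc_div k p; have := ltn_ceil k p0; move: (k %/ p)%N h0 => h.
  by rewrite mulSn; split=> //; nia.
have hk : (2 * h <= k)%N by rewrite (leq_trans _ hpk) // mulnC leq_mul2l p1 orbT.
have hk' : (h <= k)%N by lia.
have k0' : (0 : R) < k%:R by rewrite ltr0n; lia.
have p0' : (0 : R) < p%:R by rewrite ltr0n; lia.
have h0' : (0 : R) < h%:R by rewrite ltr0n.
pose x : R := h%:R / k%:R.
have x0 : 0 < x by rewrite divr_gt0.
have kx : k%:R * x = h%:R by rewrite mulrC divfK // gt_eqF.
have xp : x <= p%:R ^-1.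
  by rewrite -[p%:R^-1]mul1r ler_pdivlMr // mulrAC ler_pdivrMr // mul1r -natrM ler_nat.
have px : x ^-1 <= 2 * p%:R.
  by rewrite invf_div ler_pdivrMr // -!natrM ler_nat; lia.
have x2 : x <= 1 / 2.
  by rewrite ler_pdivrMr // mulrAC ler_pdivlMr // !mul1r mulrC -natrM ler_nat.
have k1 := subnK hk'.
have /andP[h1 _] := convex_seq_sub (k - h) h cu; rewrite k1 in h1.
have /andP[_ h2] := convex_seq_sub k h cu.
have := hu (k - h)%N; have := hu k; have := hu (k + h)%N.
rewrite (_ : 0 < k + h <= 2 * k)%N; last by lia.
rewrite (_ : 0 < k <= 2 * k)%N; last by lia.
rewrite (_ : 0 < k - h <= 2 * k)%N; last by lia.
move=> /(_ isT) h3 /(_ isT) h4 /(_ isT) h5.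
rewrite natrD in h3; rewrite natrB // in h5.
have [h3' h4' h5'] : [/\ (1 + x) ^+ 2 * (k%:R ^+ 2 * u (k + h)%N) <= w + e,
    w - e <= k%:R ^+ 2 * u k & (1 - x) ^+ 2 * (k%:R ^+ 2 * u (k - h)%N) <= w + e].
  rewrite -kx in h3 h5.
  move: h3 h4 h5; rewrite !ler_norml => /andP[_ h3] /andP[h4 _] /andP[_ h5].
  by split; [rewrite -lerBlDl; apply: le_trans h3 | | rewrite -lerBlDl; apply: le_trans h5];
    [|lra|]; rewrite le_eqVlt; apply/orP; left; apply/eqP; ring.
have k20 : 0 < k%:R ^+ 2 :> R by rewrite exprn_gt0.
have xD : x * (k%:R ^+ 3 * (u k - u k.+1)) = k%:R ^+ 2 * (h%:R * (u k - u k.+1)).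
  by rewrite -kx; ring.
have up := decrement_upper x0 x2 w01 e0 h5' h4' (D := k%:R ^+ 3 * (u k - u k.+1)).
have lo := decrement_lower x0 x2 w01 e0 h3' h4' (D := k%:R ^+ 3 * (u k - u k.+1)).
rewrite xD -mulrBr ler_pM2l // in up; rewrite xD -mulrBr ler_pM2l // in lo.
have ex : e / x <= 2 * p%:R * e by rewrite mulrC ler_wpM2r.
have ex6 : 6 * e / x = 6 * (e / x) by rewrite mulrA.
have ex3 : 3 * e / x = 3 * (e / x) by rewrite mulrA.
have ex0 : 0 <= e / x by rewrite divr_ge0 // ltW.
move: (up h1) (lo h2); rewrite ex6 ex3 ler_norml.
rewrite (_ : 12 * p%:R * e = 6 * (2 * p%:R * e)); last by ring.
move: xp ex ex0 x0; move: (e / x) (2 * p%:R * e) (p%:R^-1) (k%:R ^+ 3 * _) => q r s t.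
by move=> *; apply/andP; split; lra.
Qed.

Lemma run_decrement_limit (e : R) : 0 < e ->
  exists M : nat, exists2 kappa : R, 0 < kappa &
  forall A B k, (M <= k)%N -> k%:R <= kappa * A%:R -> k%:R <= kappa * B%:R ->
    `|4 * k%:R ^+ 3 * ((sum_runs coprime A B k)%:R - (sum_runs coprime A B k.+1)%:R)
        / (A%:R * B%:R) ^+ 2 - 2 * (pi ^+ 2 / 6)^-1| <= e.
Proof.
(* This gives 12/p <= e/2 and 1 < p; [e'] is then fixed by 12 p e' = e/2. *)
move=> e0; pose p := (Num.truncn (24 / e)).+2.
have p0 : (0 : R) < p%:R by rewrite ltr0n.
have pe : 12 / p%:R <= e / 2.
  rewrite ler_pdivrMr // mulrC -ler_pdivrMr ?divr_gt0 //.
  apply: (@le_trans _ _ (24 / e)); last first.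
    by apply: (le_trans (ltW (truncnS_gt _))); rewrite ler_nat.
  by rewrite le_eqVlt; apply/orP; left; apply/eqP; field; rewrite gt_eqF.
pose e' := e / (24 * p%:R); have e'0 : 0 < e' by rewrite divr_gt0 // mulr_gt0.
have [kappa kap0 H] := run_density_limit e'0.
(* Halving [kappa] makes the density estimate valid at all indices up to 2k. *)
exists p, (kappa / 2); first by rewrite divr_gt0.
move=> A B k pk kA kB.
pose u i : R := 4 * (sum_runs coprime A B i)%:R / (A%:R * B%:R) ^+ 2.
have cu : convex_seq u.
  move=> i; rewrite /u; have := sum_runs_convex coprime A B i.
  rewrite -(ler_nat R) natrM natrD.
  have : 0 <= (A%:R * B%:R) ^- 2 :> R by rewrite invr_ge0 exprn_ge0 // mulr_ge0.
  move: (_ ^- 2) (sum_runs _ _ _ i)%:R (sum_runs _ _ _ i.+1)%:R (sum_runs _ _ _ i.+2)%:R.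
  by move=> *; nra.
have := @convex_seq_decrement u (@pi R ^+ 2 / 6)^-1 e' p k cu.
have /andP[w0 w1] := inv_pi2_bounds R; rewrite (ltW w0) w1 => /(_ isT (ltW e'0) isT pk).
have -> : k%:R ^+ 3 * (u k - u k.+1) = 4 * k%:R ^+ 3 * ((sum_runs coprime A B k)%:R
    - (sum_runs coprime A B k.+1)%:R) / (A%:R * B%:R) ^+ 2 by rewrite /u; ring.
move=> G; apply: (le_trans (G _)); last first.
  rewrite (_ : 12 * p%:R * e' = e / 2); last by rewrite /e'; field; rewrite gt_eqF.
  by move: pe; move: (12 / p%:R) => q; lra.
move=> i /andP[i0 i2].
have i2' : i%:R <= 2 * k%:R :> R by rewrite -natrM ler_nat.
have := H A B i i0; rewrite /run_density /u.
have -> : 4 * i%:R ^+ 2 * (sum_runs coprime A B i)%:R / (A%:R * B%:R) ^+ 2 =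
  i%:R ^+ 2 * (4 * (sum_runs coprime A B i)%:R / (A%:R * B%:R) ^+ 2) :> R by ring.
by apply; lra.
Qed.

End Tauberian.

(** * Cardinalities and coprime pairs *)

Section Counting.

Lemma num_elts_le (T : choiceType) (X Y : set T) :
  finite_set Y -> X `<=` Y -> (num_elts X <= num_elts Y)%N.
Proof.
move=> fY XY; apply: fsubset_leq_card; rewrite -fset_set_sub //.
exact: sub_finite_set fY.
Qed.

Lemma num_elts_inj (T U : choiceType) (f : T -> U) (X : set T) :
  finite_set X -> {in X &, injective f} -> num_elts (f @` X) = num_elts X.
Proof.
move=> fX finj; rewrite /num_elts fset_set_image // card_in_imfset //= => x y.
by rewrite !in_fset_set //; exact: finj.
Qed.

Lemma num_elts_image_le (T U : choiceType) (f : T -> U) (X : set T) :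
  finite_set X -> (num_elts (f @` X) <= num_elts X)%N.
Proof. by move=> fX; rewrite /num_elts fset_set_image // leq_imfset_card. Qed.

Lemma num_elts_II n : num_elts `I_n = n.
Proof. exact: card_fset_set. Qed.

Lemma num_elts_pred (T : finType) (P : pred T) : num_elts [set x | P x] = #|P|.
Proof.
rewrite /num_elts -card_finset; congr (#|` _ |); apply/fsetP => x.
rewrite in_fset_set; last exact: finite_finset.
by rewrite !inE; apply/idP/idP; rewrite ?inE.
Qed.

Lemma num_elts_setU (T : choiceType) (X Y : set T) :
  finite_set X -> finite_set Y -> X `&` Y = set0 ->
  num_elts (X `|` Y) = (num_elts X + num_elts Y)%N.
Proof.
move=> fX fY XY; rewrite /num_elts fset_setU // cardfsU -fset_setI // XY.
by rewrite fset_set0 cardfs0 subn0.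
Qed.

(** By Gauss's lemma a divides u. This describes the lattice vectors parallel to a primitive one. *)
Lemma coprime_lattice_step a b u v : (0 < a)%N -> coprime a b -> (a * v = b * u)%N ->
  exists t, u = (t * a)%N /\ v = (t * b)%N.
Proof.
move=> a0 ab e; have /dvdnP[t ut] : (a %| u)%N.
  by rewrite -(Gauss_dvdr _ ab) -e dvdn_mulr.
exists t; split=> //; apply/eqP; rewrite -(eqn_pmul2l a0) e ut.
by rewrite mulnC mulnAC mulnC.
Qed.

Lemma coprime_fraction_inj a b a' b' : (0 < a)%N -> coprime a b -> coprime a' b' ->
  (b * a' = b' * a)%N -> a = a' /\ b = b'.
Proof.
move=> a0 ab ab' e.
have aa' : a = a'.
  apply/eqP; rewrite eqn_dvd -(Gauss_dvdr a' ab) e dvdn_mull //=.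
  by rewrite -(Gauss_dvdr a ab') -e dvdn_mull.
split=> //; apply/eqP; rewrite -(eqn_pmul2r a0); apply/eqP.
by rewrite -e aa'.
Qed.

Lemma sum_interval N lo q : (\sum_(i < N.+1) (lo < i <= N - q))%N = (N - q - lo)%N.
Proof.
rewrite -(big_mkord xpredT (fun i => (lo < i <= N - q) : nat)).
have : (N - q <= N)%N by exact: leq_subr.
move: (N - q)%N => M MN; transitivity ((minn N.+1 M.+1).-1 - lo)%N; last by lia.
elim: N.+1 => [|n IH]; first by rewrite big_geq // min0n.
rewrite big_nat_recr //= IH; case: (boolP (lo < n <= M)%N) => h /=; first by lia.
by rewrite addn0; lia.
Qed.

End Counting.

(** * Rich lines of positive slope, by primitive step and first point *)

Section Lines.
Variable R : realType.
Implicit Types (A B a b i j m r : nat) (s mu c : R).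

Definition box A B : set (R * R) :=
  [set p | exists i j, [/\ p = (i%:R, j%:R), (0 < i <= A)%N & (0 < j <= B)%N]].

Definition slope_line mu c : set (R * R) := [set p | p.2 = mu * p.1 + c].

Definition pos_rich A B s r : set (set (R * R)) :=
  [set l | exists mu c, [/\ 0 < mu, mu != s, l = slope_line mu c &
                           (r <= num_elts (box A B `&` l))%N]].

Definition step_line a b i j : set (R * R) :=
  slope_line (b%:R / a%:R) (j%:R - b%:R / a%:R * i%:R).

Definition primitive_step s a b := coprime a b && (b%:R / a%:R != s).

Lemma slope_line_inj mu c mu' c' :
  slope_line mu c = slope_line mu' c' -> mu = mu' /\ c = c'.
Proof.
move=> e; have h0 : slope_line mu' c' (0, c) by rewrite -e /slope_line /= mulr0 add0r.
have h1 : slope_line mu' c' (1, mu + c) by rewrite -e /slope_line /= mulr1.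
by move: h0 h1; rewrite /slope_line /= mulr0 mulr1 add0r => -> /addIr.
Qed.

Lemma box_finite A B : finite_set (box A B).
Proof.
apply: (@sub_finite_set _ _ ((fun x : nat * nat => (x.1%:R, x.2%:R)) @`
    (`I_A.+1 `*` `I_B.+1))).
  by move=> _ [i [j [-> /andP[_ iA] /andP[_ jB]]]]; exists (i, j).
by apply: finite_image; apply: finite_setX; exact: finite_II.
Qed.

(** The cross-multiplied equation is arranged to avoid subtraction in [nat]. *)
Lemma step_lineP a b i j i' j' : (0 < a)%N ->
  step_line a b i j (i'%:R, j'%:R) <-> (a * j' + b * i = a * j + b * i')%N.
Proof.
move=> a0; have a0' : a%:R != 0 :> R by rewrite pnatr_eq0 -lt0n.
rewrite /step_line /slope_line /=; split=> [e|/(congr1 (fun n => n%:R : R))].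
  apply/eqP; rewrite -(eqr_nat R) !natrD !natrM e; apply/eqP; field.
  exact: a0'.
rewrite !natrD !natrM => e; apply: (mulfI a0').
have -> : a%:R * j'%:R = a%:R * j%:R + b%:R * i'%:R - b%:R * i%:R :> R.
  by rewrite -e addrK.
by field.
Qed.

(* (i, j) is the first of at least m + 1 points of the box met by steps (a, b). *)
Definition line_start A B a b m i j :=
  [&& (0 < i <= A - m * a)%N, (0 < j <= B - m * b)%N & (i <= a)%N || (j <= b)%N].

Lemma step_line_num A B a b m i j : (0 < a)%N -> (0 < i <= A - m * a)%N ->
  (0 < j <= B - m * b)%N -> (m < num_elts (box A B `&` step_line a b i j))%N.
Proof.
move=> a0 hi hj; pose f t : R * R := ((i + t * a)%:R, (j + t * b)%:R).
have finj : injective f.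
  by move=> t t' [/eqP]; rewrite eqr_nat eqn_add2l eqn_pmul2r // => /eqP.
rewrite -[X in (X <= _)%N](num_elts_II m.+1) -(num_elts_inj (f := f)) //; last first.
  by move=> t t' _ _; exact: finj.
apply: num_elts_le; first by apply: finite_setIl; exact: box_finite.
move=> _ [t /= tm <-]; split.
  have ta : (t * a <= m * a)%N by rewrite leq_mul2r -ltnS tm orbT.
  have tb : (t * b <= m * b)%N by rewrite leq_mul2r -ltnS tm orbT.
  by exists (i + t * a)%N, (j + t * b)%N; split=> //; lia.
by apply/step_lineP => //; ring.
Qed.

Lemma step_line_pos_rich A B s a b m i j : (0 < a)%N -> (0 < b)%N ->
  primitive_step s a b -> line_start A B a b m i j ->
  pos_rich A B s m.+1 (step_line a b i j).
Proof.
move=> a0 b0 /andP[_ sab] /and3P[hi hj _].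
exists (b%:R / a%:R), (j%:R - b%:R / a%:R * i%:R); split=> //.
  by rewrite divr_gt0 // ltr0n.
exact: step_line_num.
Qed.

(** The first point is the leftmost grid point of the line; the step is the vector to another grid
    point, divided by the gcd of its coordinates. *)
Lemma pos_rich_step_line A B s m l : (0 < m)%N -> pos_rich A B s m.+1 l ->
  exists a b i j, [/\ (0 < a <= A)%N /\ (0 < b <= B)%N, primitive_step s a b,
    line_start A B a b m i j & l = step_line a b i j].
Proof.
move=> m0 [mu [c [mu0 mus -> num]]].
have fin : finite_set (box A B `&` slope_line mu c).
  by apply: finite_setIl; exact: box_finite.
pose on i j := [/\ (0 < i <= A)%N, (0 < j <= B)%N & j%:R = mu * i%:R + c].
have [i0 [[j0 on0] min0]] : exists i0, (exists j, on i0 j) /\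
    forall i j, on i j -> (i0 <= i)%N.
  have ex : exists i, `[< exists j, on i j >].
    apply: contrapT => nex; move: num; rewrite leqNgt => /negP; apply.
    rewrite (_ : _ `&` _ = set0) ?/num_elts ?fset_set0 ?cardfs0 //.
    rewrite -subset0 => p [[i [j [-> hi hj]]] e].
    by apply: nex; exists i; apply/asboolP; exists j.
  case: (ex_minnP ex) => i0 /asboolP on0 min0; exists i0; split=> // i j onij.
  by apply: min0; apply/asboolP; exists j.
have [hi0 hj0 e0] := on0.
(* A second point exists because m + 1 >= 2. *)
have [i1 [j1 [on1 i01]]] : exists i j, on i j /\ (i0 < i)%N.
  apply: contrapT => nex; move: num; rewrite leqNgt => /negP; apply.
  apply: (@leq_ltn_trans 1); last by [].
  rewrite -[X in (_ <= X)%N](_ : num_elts [set (i0%:R : R, j0%:R : R)] = 1%N); last first.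
    by rewrite /num_elts fset_set1 cardfs1.
  apply: num_elts_le; first exact: finite_set1.
  move=> p [[i [j [-> hi hj]]] /= e]; have onij : on i j by [].
  have := min0 _ _ onij; rewrite leq_eqVlt => /orP[/eqP ei|lt]; last first.
    by case: nex; exists i, j.
  by have [_ _ e'] := onij; rewrite e' -ei -e0.
have [hi1 hj1 e1] := on1.
have i01' : 0 < i1%:R - i0%:R :> R by rewrite subr_gt0 ltr_nat.
have dj : j1%:R - j0%:R = mu * (i1%:R - i0%:R) by rewrite e0 e1; ring.
have j01 : (j0 < j1)%N by rewrite -(ltr_nat R) -subr_gt0 dj mulr_gt0.
pose g := gcdn (i1 - i0) (j1 - j0).
have g0 : (0 < g)%N by rewrite gcdn_gt0 subn_gt0 i01.
pose a := ((i1 - i0) %/ g)%N; pose b := ((j1 - j0) %/ g)%N.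
have ga : (a * g = i1 - i0)%N by rewrite divnK // dvdn_gcdl.
have gb : (b * g = j1 - j0)%N by rewrite divnK // dvdn_gcdr.
have cab : coprime a b.
  by rewrite /coprime -(eqn_pmul2r g0) muln_gcdl ga gb mul1n.
clearbody a b g.
have a0 : (0 < a)%N by case: (a) ga => //; rewrite mul0n; lia.
have b0 : (0 < b)%N by case: (b) gb => //; rewrite mul0n; lia.
have g0' : g%:R != 0 :> R by rewrite pnatr_eq0 -lt0n.
have a0' : a%:R != 0 :> R by rewrite pnatr_eq0 -lt0n.
have muE : mu = b%:R / a%:R.
  move: dj; rewrite -!natrB ?(ltnW i01) ?(ltnW j01) // -ga -gb !natrM => dj.
  apply: (mulIf a0'); rewrite divfK //; apply: (mulIf g0').
  by rewrite dj mulrA.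
have lE : slope_line mu c = step_line a b i0 j0.
  by rewrite /step_line -muE e0 addrAC subrr add0r.
have chain i j : on i j -> exists t, i = (i0 + t * a)%N /\ j = (j0 + t * b)%N.
  move=> onij; have [hi hj e] := onij; have ii := min0 _ _ onij.
  have : slope_line mu c (i%:R, j%:R) by [].
  rewrite lE => /(step_lineP _ _ _ _ _ a0) eN.
  have jj : (j0 <= j)%N.
    by rewrite -(leq_pmul2l a0) -(leq_add2r (b * i)) -eN leq_add2l leq_mul2l ii orbT.
  have [|t [ti tj]] := @coprime_lattice_step a b (i - i0) (j - j0) a0 cab.
    by rewrite !mulnBr; move: eN; lia.
  by exists t; rewrite -ti -tj !subnKC.
(* Otherwise only multiples t < m of the step stay in the box, leaving at most m points. *)
have far : (i0 + m * a <= A)%N && (j0 + m * b <= B)%N.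
  apply: contraT => nfar; move: num; rewrite ltnNge => /negP; case.
  pose f t : R * R := ((i0 + t * a)%:R, (j0 + t * b)%:R).
  rewrite -[X in (_ <= X)%N](num_elts_II m).
  apply: leq_trans (num_elts_image_le f (finite_II m)).
  apply: num_elts_le; first by apply: finite_image; exact: finite_II.
  move=> p [[i [j [-> hi hj]]] e]; have [t [ti tj]] := chain i j (And3 hi hj e).
  exists t; last by rewrite /f ti tj.
  rewrite /= ltnNge; apply: contra nfar => mt.
  have ta : (m * a <= t * a)%N by rewrite leq_mul2r mt orbT.
  have tb : (m * b <= t * b)%N by rewrite leq_mul2r mt orbT.
  by apply/andP; split; lia.
exists a, b, i0, j0; case/andP: far => fa fb; split.
- have am : (a <= m * a)%N by rewrite leq_pmull.
  have bm : (b <= m * b)%N by rewrite leq_pmull.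
  by split; lia.
- by rewrite /primitive_step cab -muE mus.
- apply/and3P; split; [by lia|by lia|].
  (* If i0 > a and j0 > b, one step back yields a grid point left of the leftmost. *)
  rewrite leqNgt [(j0 <= b)%N]leqNgt -negb_and; apply/negP => /andP[ia jb].
  have : on (i0 - a)%N (j0 - b)%N.
    split; [by lia|by lia|].
    rewrite !natrB ?(ltnW ia) ?(ltnW jb) // e0 muE; field.
    exact: a0'.
  by move/min0; lia.
- exact: lE.
Qed.

Lemma step_line_inj A B m a b i j a' b' i' j' :
  (0 < a)%N -> (0 < a')%N -> coprime a b -> coprime a' b' ->
  line_start A B a b m i j -> line_start A B a' b' m i' j' ->
  step_line a b i j = step_line a' b' i' j' -> [/\ a = a', b = b', i = i' & j = j'].
Proof.
move=> a0 a0' cab cab' st st' e.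
have ra0 : a%:R != 0 :> R by rewrite pnatr_eq0 -lt0n.
have ra0' : a'%:R != 0 :> R by rewrite pnatr_eq0 -lt0n.
have [/eqP mu _] := slope_line_inj e.
rewrite eqr_div // -!natrM eqr_nat in mu.
have [aa bb] := coprime_fraction_inj a0 cab cab' (eqP mu); subst a' b'.
(* Two starts on one line differ by t steps; t > 0 would leave room for a step back from the later
   one. *)
have key x y x' y' : line_start A B a b m x y -> line_start A B a b m x' y' ->
    step_line a b x y = step_line a b x' y' -> (x <= x')%N -> x = x' /\ y = y'.
  move=> /and3P[hx hy _] /and3P[_ _ st2] e2 xx.
  have : step_line a b x y (x'%:R, y'%:R) by rewrite e2; apply/step_lineP.
  move/(step_lineP _ _ _ _ _ a0) => eN.
  have yy : (y <= y')%N.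
    by rewrite -(leq_pmul2l a0) -(leq_add2r (b * x')) -eN leq_add2l leq_mul2l xx orbT.
  have [|t [tx ty]] := @coprime_lattice_step a b (x' - x) (y' - y) a0 cab.
    by rewrite !mulnBr; move: eN; lia.
  case: t tx ty => [|t] tx ty; first by lia.
  by move: tx ty st2; rewrite !mulSn; lia.
have [ii|ii] := leqP i i'; first by have [] := key _ _ _ _ st st' e ii.
by have [-> ->] := key _ _ _ _ st' st (esym e) (ltnW ii).
Qed.

(** A point with m steps ahead fails to be a start exactly when i > a and j > b; a step back then
    matches it with a point having m + 1 steps ahead. *)
Lemma line_start_count A B a b m :
  (\sum_(i < A.+1) \sum_(j < B.+1) line_start A B a b m i j)%N =
  (runs A B a b m - runs A B a b m.+1)%N.
Proof.
apply/eqP; rewrite -(eqn_add2r (runs A B a b m.+1)) subnK ?leq_runs //; apply/eqP.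
have prod lo lo' : (\sum_(i < A.+1) \sum_(j < B.+1)
    ((lo < i <= A - m * a) && (lo' < j <= B - m * b))%N =
    (A - m * a - lo) * (B - m * b - lo'))%N.
  rewrite -!sum_interval big_distrlr /=; apply: eq_bigr => i _; apply: eq_bigr => j _.
  by rewrite mulnb.
have -> : runs A B a b m = ((A - m * a - 0) * (B - m * b - 0))%N by rewrite !subn0.
have -> : runs A B a b m.+1 = ((A - m * a - a) * (B - m * b - b))%N.
  by rewrite /runs !mulSn; congr (_ * _)%N; lia.
rewrite -!prod -big_split /=; apply: eq_bigr => i _.
rewrite -big_split /=; apply: eq_bigr => j _.
rewrite /line_start; case: (ltnP a i) => ai; case: (ltnP b j) => bj;
  rewrite /= ?andbF ?andbT ?addn0 //.
by rewrite (leq_ltn_trans (leq0n a) ai) (leq_ltn_trans (leq0n b) bj).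
Qed.

(** The quadruples (a, b, i, j) parametrise the lines bijectively; placing them in a finite type
    turns the count into a sum over steps of the number of starts. *)
Lemma num_pos_rich A B s m : (0 < m)%N -> num_elts (pos_rich A B s m.+1) =
  (sum_runs (primitive_step s) A B m - sum_runs (primitive_step s) A B m.+1)%N.
Proof.
move=> m0; pose T := ('I_A.+1 * 'I_B.+1 * ('I_A.+1 * 'I_B.+1))%type.
pose P (x : T) := [&& (0 < x.1.1)%N, (0 < x.1.2)%N, primitive_step s x.1.1 x.1.2 &
  line_start A B x.1.1 x.1.2 m x.2.1 x.2.2].
have -> : pos_rich A B s m.+1 =
    (fun x : T => step_line x.1.1 x.1.2 x.2.1 x.2.2) @` [set x | P x].
  apply/seteqP; split=> [l /(pos_rich_step_line m0)|_ [x /and4P[a0 b0 st ls] <-]].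
    move=> [a [b [i [j [[/andP[a0 aA] /andP[b0 bB]] st ls ->]]]]].
    have iA : (i < A.+1)%N by case/and3P: ls; lia.
    have jB : (j < B.+1)%N by case/and3P: ls; lia.
    exists (Ordinal (aA : (a < A.+1)%N), Ordinal (bB : (b < B.+1)%N),
      (Ordinal iA, Ordinal jB)) => //=.
    by apply/and4P.
  exact: step_line_pos_rich.
rewrite num_elts_inj; last 2 first.
- exact: finite_finset.
- move=> [[a b] [i j]] [[a' b'] [i' j']]; rewrite !inE => /and4P[/= a0 _ /andP[ab _] ls].
  move=> /and4P[/= a0' _ /andP[ab' _] ls'] e.
  have [/val_inj -> /val_inj -> /val_inj -> /val_inj ->] :=
    step_line_inj a0 a0' ab ab' ls ls' e.
  by [].
rewrite num_elts_pred -sum1_card big_mkcond /=.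
have sum_P Q (F : nat -> nat -> nat) : (\sum_(1 <= a < A.+1) \sum_(1 <= b < B.+1 | Q a b) F a b
    = \sum_(a < A.+1) \sum_(b < B.+1) if [&& 0 < a, 0 < b & Q a b] then F a b else 0)%N.
  rewrite -(big_mkord xpredT (fun a => \sum_(b < B.+1)
    if [&& 0 < a, 0 < b & Q a b] then F a b else 0)%N) /=.
  rewrite [RHS]big_ltn // [X in _ = (X + _)%N]big1 // add0n; apply: eq_big_nat => a /andP[-> _] /=.
  rewrite -(big_mkord xpredT (fun b => if (0 < b) && Q a b then F a b else 0)%N) /=.
  by rewrite [RHS]big_ltn //= add0n big_mkcond; apply: eq_big_nat => b /andP[-> _].
pose C a b := [&& 0 < a, 0 < b & primitive_step s a b]%N.
pose D a b := (runs A B a b m - runs A B a b m.+1)%N.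
transitivity (\sum_(u : 'I_A.+1 * 'I_B.+1) if C u.1 u.2 then D u.1 u.2 else 0)%N.
  transitivity (\sum_(u : 'I_A.+1 * 'I_B.+1) \sum_(v : 'I_A.+1 * 'I_B.+1) P (u, v))%N.
    rewrite pair_bigA; apply: eq_bigr => -[u v] _.
    have -> : ((u, v) \in P) = P (u, v) by [].
    by case: (P (u, v)) => [|].
  apply: eq_bigr => -[a b] _ /=; rewrite /C.
  case: (boolP [&& 0 < a, 0 < b & primitive_step s a b]%N) => [/and3P[a0 b0 st]|nC].
    rewrite /D -line_start_count pair_bigA; apply: eq_bigr => -[i j] _.
    by rewrite /P /= a0 b0 st.
  rewrite big1 // => v _; apply/eqP; rewrite eqb0; apply: contra nC.
  by case/and4P => /= -> -> ->.
rewrite /sum_runs !sum_P; apply/eqP.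
rewrite -(pair_bigA _ (fun (a : 'I_A.+1) (b : 'I_B.+1) => if C a b then D a b else 0%N)) /=.
(* Adding the subtracted sum to both sides permits a termwise comparison. *)
rewrite -(eqn_add2r (\sum_(a < A.+1) \sum_(b < B.+1)
  if C a b then runs A B a b m.+1 else 0)%N) subnK; last first.
  apply: leq_sum => a _; apply: leq_sum => b _.
  by case: ifP => // _; exact: leq_runs.
rewrite -big_split /=; apply/eqP; apply: eq_bigr => a _.
rewrite -big_split /=; apply: eq_bigr => b _; rewrite /C.
by case: ifP => // _; rewrite /D subnK // leq_runs.
Qed.

End Lines.

(** * Double counting of incidences *)

Section Incidences.

Lemma sum_fset_pred (T : choiceType) (X : set T) (p : pred T) : finite_set X ->
  (\sum_(x <- fset_set X) (p x : nat))%N = num_elts [set x | X x /\ p x].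
Proof.
move=> fX; have fY : finite_set [set x | X x /\ p x].
  by apply: sub_finite_set fX => x [].
transitivity (count p (fset_set X)).
  by rewrite -sum1_count [RHS]big_mkcond; apply: eq_bigr => x _; case: (p x).
rewrite -size_filter; apply/perm_size/uniq_perm => [||x].
- by rewrite filter_uniq // fset_uniq.
- exact: fset_uniq.
rewrite mem_filter !in_fset_set //; apply/andP/idP => [[px]|].
  by rewrite !inE.
by rewrite !inE => -[].
Qed.

Lemma incidences_sum (R : realType) (P : set (R * R)) (L : set (set (R * R))) :
  finite_set P -> finite_set L ->
  incidences P L = (\sum_(l <- fset_set L) num_elts (P `&` l))%N.
Proof.
move=> fP fL; rewrite /incidences.
set X := [set pl : (R * R) * set (R * R) | _].
have fX : finite_set X.
  apply: (@sub_finite_set _ _ (P `*` L)); last exact: finite_setX.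
  by move=> [p l] [].
transitivity (\sum_(x <- fset_set X) \sum_(l <- fset_set L) (x.2 == l))%N.
  rewrite /num_elts card_fset_sum1; apply: eq_big_seq => x.
  rewrite in_fset_set // inE => -[_ Lx _].
  rewrite (sum_fset_pred (fun l => x.2 == l)) //.
  rewrite (_ : [set _ | _] = [set x.2]) ?/num_elts ?fset_set1 ?cardfs1 //.
  by apply/seteqP; split=> l /= => [[_ /eqP ->]|->].
rewrite exchange_big /=; apply: eq_big_seq => l; rewrite in_fset_set // inE => Ll.
rewrite (sum_fset_pred (fun x => x.2 == l)) //.
rewrite -(@num_elts_inj _ _ (fun p => (p, l)) (P `&` l)).
- congr num_elts; apply/seteqP; split=> [[p l'] /= [[Pp _ lp] /eqP ll]|].
    by exists p; rewrite -?ll.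
  by move=> _ [p [Pp lp] <-] /=.
- exact: finite_setIl.
- by move=> p p' _ _ [].
Qed.

Lemma sum_ltn (n N : nat) : (n <= N)%N -> (\sum_(0 <= k < N) (k < n))%N = n.
Proof.
move=> nN; transitivity (minn N n); last by rewrite (minn_idPr nN).
elim: N {nN} => [|N IH]; first by rewrite big_geq // min0n.
by rewrite big_nat_recr //= IH; case: (ltnP N n) => h /=; lia.
Qed.

Lemma telescope_subn (f : nat -> nat) (m q : nat) : (forall k, f k.+1 <= f k)%N ->
  (\sum_(m <= k < m + q) (f k - f k.+1))%N = (f m - f (m + q))%N.
Proof.
move=> hf; have mono p : (f (m + p) <= f m)%N.
  by elim: p => [|p IH]; rewrite ?addn0 // addnS (leq_trans (hf _)).
elim: q => [|q IH]; first by rewrite addn0 big_geq // subnn.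
rewrite addnS big_nat_recr ?leq_addr //= IH.
by have := hf (m + q)%N; have := mono q; lia.
Qed.

End Incidences.

(** * Rich lines of either sign of slope *)

Section Rich.
Variable R : realType.
Implicit Types (A B m r : nat) (s mu c : R).

Definition rich A B s r : set (set (R * R)) :=
  [set l | exists mu c, [/\ mu != 0, `|mu| != s, l = slope_line mu c &
                           (r <= num_elts (@box R A B `&` l))%N]].

(** Reflection in the horizontal line of height (B + 1)/2, which preserves the box and negates
    slopes. *)
Definition flip B (p : R * R) : R * R := (p.1, B.+1%:R - p.2).

Lemma flipK B : involutive (flip B).
Proof. by move=> [x y]; rewrite /flip /= opprB addrC subrK. Qed.

Lemma preimage_flipK B (l : set (R * R)) : flip B @^-1` (flip B @^-1` l) = l.
Proof. by apply/seteqP; split=> p /=; rewrite flipK. Qed.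

Lemma flip_slope_line B mu c :
  flip B @^-1` slope_line mu c = slope_line (- mu) (B.+1%:R - c).
Proof.
apply/seteqP; split=> -[x y]; rewrite /flip /slope_line /= => e.
  by rewrite mulNr -[y](subKr B.+1%:R) e; ring.
by rewrite e; ring.
Qed.

Lemma flip_box A B : flip B @^-1` @box R A B = @box R A B.
Proof.
have sub p : @box R A B p -> @box R A B (flip B p).
  move=> [i [j [-> hi hj]]]; exists i, (B.+1 - j)%N; split=> //; last by lia.
  by rewrite /flip /= natrB //; lia.
by apply/seteqP; split=> p /=; [move/sub; rewrite flipK|exact: sub].
Qed.

Lemma num_flip B (X : set (R * R)) : finite_set X ->
  num_elts (flip B @^-1` X) = num_elts X.
Proof.
move=> fX; rewrite -(num_elts_inj (f := flip B) fX); last first.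
  by move=> p p' _ _; exact: (inv_inj (flipK B)).
congr num_elts; apply/seteqP; split=> [p /= Xp|_ [p Xp <-] /=].
  by exists (flip B p) => //; rewrite flipK.
by rewrite flipK.
Qed.

Lemma num_flip_line A B (l : set (R * R)) :
  num_elts (@box R A B `&` flip B @^-1` l) = num_elts (@box R A B `&` l).
Proof.
rewrite -{1}(flip_box A B) -preimage_setI num_flip //.
by apply: finite_setIl; exact: box_finite.
Qed.

Lemma richE A B s r : rich A B s r =
  pos_rich A B s r `|` (preimage (flip B)) @` pos_rich A B s r.
Proof.
apply/seteqP; split=> [l [mu [c [mu0 mus le num]]]|l].
  have [muP|muN|mu00] := ltgtP 0 mu; last by rewrite -mu00 eqxx in mu0.
    by left; exists mu, c; split=> //; rewrite -(gtr0_norm muP).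
  right; exists (flip B @^-1` l).
    exists (- mu), (B.+1%:R - c); rewrite oppr_gt0 -(ltr0_norm muN) num_flip_line.
    by split=> //; rewrite le flip_slope_line ltr0_norm.
  exact: preimage_flipK.
case=> [[mu [c [mu0 mus -> num]]]|[_ [mu [c [mu0 mus -> num]]] <-]].
  by exists mu, c; rewrite gt_eqF // gtr0_norm.
exists (- mu), (B.+1%:R - c); rewrite oppr_eq0 normrN gt_eqF // gtr0_norm // num_flip_line.
by split=> //; exact: flip_slope_line.
Qed.

Lemma pos_rich_finite A B s m : (0 < m)%N -> finite_set (pos_rich A B s m.+1).
Proof.
move=> m0; apply: (@sub_finite_set _ _ ((fun x : nat * nat * (nat * nat) =>
  @step_line R x.1.1 x.1.2 x.2.1 x.2.2) @`
    ((`I_A.+1 `*` `I_B.+1) `*` (`I_A.+1 `*` `I_B.+1)))).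
  move=> l /(pos_rich_step_line m0).
  move=> [a [b [i [j [[/andP[a0 aA] /andP[b0 bB]] st ls ->]]]]].
  exists (a, b, (i, j)) => //=; case/and3P: ls => hi hj _.
  by split; split=> /=; lia.
by apply: finite_image; apply: finite_setX; apply: finite_setX; exact: finite_II.
Qed.

Lemma rich_finite A B s m : (0 < m)%N -> finite_set (rich A B s m.+1).
Proof.
move=> m0; rewrite richE finite_setU; split; first exact: pos_rich_finite.
by apply: finite_image; exact: pos_rich_finite.
Qed.

Lemma num_rich A B s m : (0 < m)%N -> num_elts (rich A B s m.+1) =
  (2 * (sum_runs (primitive_step s) A B m - sum_runs (primitive_step s) A B m.+1))%N.
Proof.
move=> m0; have f1 := pos_rich_finite A B s m0.
have f2 := finite_image (preimage (flip B)) f1.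
rewrite richE (num_elts_setU f1 f2); last first.
  rewrite -subset0 => _ [[mu [c [mu0 _ -> _]]] [_ [mu' [c' [mu'0 _ -> _]]]]].
  rewrite flip_slope_line => /slope_line_inj[e _].
  by move: mu0; rewrite -e oppr_gt0 ltNge ltW.
rewrite (num_elts_inj f1); last by move=> l l' _ _; exact: (can_inj (@preimage_flipK B)).
by rewrite num_pos_rich // mul2n addnn.
Qed.

(* Each line contributes one incidence to every level k up to its number of
   points, and the lines counted at level k are the k-rich ones. *)
Lemma incidences_rich A B s m (S := sum_runs (primitive_step s) A B) : (0 < m)%N ->
  incidences (@box R A B) (rich A B s m.+1) =
  (2 * (m.+1 * (S m - S m.+1) + S m.+1))%N.
Proof.
move=> m0; have fr := rich_finite A B s m0.
rewrite incidences_sum //; last exact: box_finite.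
(* [N] bounds the number of points on any line, and S vanishes at it since N >= A. *)
pose N := (m.+1 + (num_elts (@box R A B) + A))%N.
have nN l : (num_elts (@box R A B `&` l) <= N)%N.
  apply: (@leq_trans (num_elts (@box R A B))); last by rewrite /N; lia.
  by apply: num_elts_le; [exact: box_finite|exact: subIsetl].
transitivity (\sum_(0 <= k < N) num_elts (rich A B s (maxn m k).+1))%N.
  transitivity (\sum_(0 <= k < N) \sum_(l <- fset_set (rich A B s m.+1))
      (k < num_elts (@box R A B `&` l)))%N.
    by rewrite exchange_big /=; apply: eq_bigr => l _; rewrite sum_ltn.
  apply: eq_bigr => k _.
  rewrite (sum_fset_pred (fun l => k < num_elts (@box R A B `&` l))%N) //.
  congr num_elts; apply/seteqP; split=> [l [[mu [c [h1 h2 h3 h4]]] h5]|l].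
    by exists mu, c; split=> //; rewrite -maxnSS geq_max h4.
  move=> [mu [c [h1 h2 h3]]]; rewrite -maxnSS geq_max => /andP[h4 h5].
  by split=> //; exists mu, c.
transitivity (\sum_(0 <= k < N) 2 * (S (maxn m k) - S (maxn m k).+1))%N.
  by apply: eq_bigr => k _; rewrite num_rich // (leq_trans m0) // leq_maxl.
rewrite -big_distrr /=; congr (2 * _)%N.
(* The m + 1 levels k <= m all count the same lines; the higher levels telescope to S (m + 1). *)
rewrite (@big_cat_nat _ _ _ m.+1) //=; last by rewrite /N leq_addr.
congr (_ + _)%N.
  rewrite (eq_big_nat _ _ (F2 := fun=> (S m - S m.+1)%N)); last first.
    by move=> k /andP[_ km]; rewrite (maxn_idPl _).
  by rewrite sum_nat_const_nat subn0.
rewrite (eq_big_nat _ _ (F2 := fun k => (S k - S k.+1)%N)); last first.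
  by move=> k /andP[mk _]; rewrite (maxn_idPr (ltnW mk)).
rewrite telescope_subn => [|k]; last exact: leq_sum_runs.
by rewrite (_ : S (_ + _)%N = 0%N) ?subn0 // /S sum_runs_eq0 //; lia.
Qed.

End Rich.

(** * From real thresholds to integer boxes *)

Section Bridge.
Variable R : realType.
Implicit Types (alpha x : R) (n : nat).

Lemma grid_box alpha n : grid alpha n =
  @box R (Num.truncn (n%:R `^ alpha)) (Num.truncn (n%:R `^ (1 - alpha))).
Proof.
have le i x : 0 <= x -> (i%:R <= x) = (i <= Num.truncn x)%N.
  by move=> x0; rewrite truncn_ge_nat.
apply/seteqP; split=> p [i [j]].
  by move=> [-> i1 i2 j1 j2]; exists i, j; rewrite i1 j1 -!le ?powR_ge0.
move=> [-> /andP[i1 i2] /andP[j1 j2]]; exists i, j.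
by rewrite !le ?powR_ge0.
Qed.

Lemma oblique_lineP (l : set (R * R)) :
  (is_line l /\ ~ axis_parallel l) <-> exists mu c, mu != 0 /\ l = slope_line mu c.
Proof.
split=> [[[a [b [c [ab lE]]]] naxis]|[mu [c [mu0 ->]]]].
  have [b0|b0] := eqVneq b 0.
    have a0 : a != 0 by apply/eqP => a0; apply: ab.
    case: naxis; left; exists (c / a); rewrite lE; apply/seteqP; split=> p /=.
      by rewrite b0 mul0r addr0 => <-; rewrite mulrAC divff // mul1r.
    by move=> ->; rewrite b0 mul0r addr0 mulrC divfK.
  have lE' : l = slope_line (- (a / b)) (c / b).
    rewrite lE; apply/seteqP; split=> p; rewrite /slope_line /= => e.
      by rewrite -e; field.
    by rewrite e; field.
  exists (- (a / b)), (c / b); split=> //.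
  by apply/eqP => mu0; apply: naxis; right; exists (c / b); rewrite lE' mu0.
split.
  exists (- mu), 1, c; split; first by case=> _ /eqP; rewrite oner_eq0.
  apply/seteqP; split=> p; rewrite /slope_line /= => e; first by rewrite e; ring.
  by rewrite -e; ring.
case=> [[x e]|[x /slope_line_inj[mu00 _]]]; last by rewrite mu00 eqxx in mu0.
have h0 : [set p : R * R | p.1 = x] (0, c) by rewrite -e /slope_line /= mulr0 add0r.
have h1 : [set p : R * R | p.1 = x] (1, mu + c) by rewrite -e /slope_line /= mulr1.
by move: h0 h1 => /= <- /eqP; rewrite oner_eq0.
Qed.

(** An integer is at least e n^alpha exactly when it exceeds m; and |mu| != s excludes both
    forbidden slopes at once. *)
Lemma rich_lines_rich alpha (e : R) n m : m%:R < e * n%:R `^ alpha <= m.+1%:R ->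
  rich_lines alpha e n =
  rich (Num.truncn (n%:R `^ alpha)) (Num.truncn (n%:R `^ (1 - alpha)))
    (n%:R `^ (1 - 2 * alpha)) m.+1.
Proof.
case/andP=> mx xm; have num k : (e * n%:R `^ alpha <= k%:R) = (m < k)%N.
  apply/idP/idP => [xk|mk]; first by rewrite -(ltr_nat R) (lt_le_trans mx).
  by rewrite (le_trans xm) // ler_nat.
rewrite /rich_lines grid_box; set s := n%:R `^ (1 - 2 * alpha); have s0 : 0 <= s by exact: powR_ge0.
apply/seteqP; split=> l.
  move=> [ll]; rewrite num => nl ax s1 s2.
  have [mu [c [mu0 lE]]] := (oblique_lineP l).1 (conj ll ax).
  exists mu, c; split=> //; rewrite eqr_norml s0 andbT negb_or.
  by apply/andP; split; apply/eqP => e'; [apply: s1|apply: s2]; exists c; rewrite lE e'.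
move=> [mu [c [mu0]]]; rewrite eqr_norml s0 andbT negb_or => /andP[s1 s2] lE nl.
have [ll ax] := (oblique_lineP l).2 (ex_intro _ mu (ex_intro _ c (conj mu0 lE))).
split=> //; rewrite ?num //; rewrite lE.
  by move=> [c' /slope_line_inj[e' _]]; rewrite e' eqxx in s1.
by move=> [c' /slope_line_inj[e' _]]; rewrite e' eqxx in s2.
Qed.

Lemma num_box (A B : nat) : num_elts (@box R A B) = (A * B)%N.
Proof.
have -> : @box R A B = (fun x : 'I_A * 'I_B => (x.1.+1%:R, x.2.+1%:R)) @` setT.
  apply/seteqP; split=> [_ [i [j [-> hi hj]]]|_ [[i j] _ <-]].
    have iA : (i.-1 < A)%N by lia.
    have jB : (j.-1 < B)%N by lia.
    by exists (Ordinal iA, Ordinal jB) => //=; rewrite !prednK //; lia.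
  by exists i.+1, j.+1; rewrite /= !ltn_ord.
rewrite num_elts_inj; last 2 first.
- exact: finite_finset.
- move=> [i j] [i' j'] _ _ /= [/eqP]; rewrite eqr_nat eqSS => /eqP/val_inj ->.
  by move=> /eqP; rewrite eqr_nat eqSS => /eqP/val_inj ->.
rewrite (_ : setT = [set x | predT x]); last by apply/seteqP; split.
by rewrite num_elts_pred -[LHS]/#|{: 'I_A * 'I_B}| card_prod !card_ord.
Qed.

Lemma pred_ceil x : 1 < x -> exists2 m : nat, (0 < m)%N & m%:R < x <= m.+1%:R.
Proof.
move=> x1; have ex : exists k : nat, x <= k%:R.
  by exists (Num.truncn x).+1; exact: ltW (truncnS_gt _).
case: (ex_minnP ex) => k xk mink.
have k1 : (1 < k)%N by rewrite -(ltr_nat R) (lt_le_trans x1).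
exists k.-1; first by lia.
rewrite prednK ?xk ?andbT; last by lia.
rewrite ltNge; apply/negP => /mink; lia.
Qed.

End Bridge.

(** * Uniform asymptotics on boxes, and the constant *)

Section Asymptotics.
Variable R : realType.
Implicit Types (A B a b m n : nat) (s e x : R).

Definition excluded_step s a b := coprime a b && (b%:R / a%:R == s).

Lemma sum_runs_split s A B m : sum_runs coprime A B m =
  (sum_runs (primitive_step s) A B m + sum_runs (excluded_step s) A B m)%N.
Proof.
rewrite /sum_runs -big_split; apply: eq_bigr => a _ /=.
rewrite (bigID (fun b => b%:R / a%:R != s)) /=; congr (_ + _)%N.
by apply: eq_bigl => b; rewrite /excluded_step negbK.
Qed.

Lemma excluded_step_inj s a b a' b' : (0 < a)%N -> (0 < a')%N ->
  excluded_step s a b -> excluded_step s a' b' -> a = a' /\ b = b'.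
Proof.
move=> a0 a0' /andP[ab /eqP e] /andP[ab' /eqP e'].
apply: coprime_fraction_inj => //; apply/eqP; rewrite -(eqr_nat R) !natrM.
by rewrite -eqr_div ?pnatr_eq0 -?lt0n // e e'.
Qed.

Lemma leq_sum_unique (r : seq nat) (F : nat -> nat) (x0 c : nat) : uniq r ->
  (forall x : nat, x \in r -> x != x0 -> F x = 0%N) -> (F x0 <= c)%N ->
  (\sum_(x <- r) F x <= c)%N.
Proof.
move=> ur F0 Fc; have [xr|xr] := boolP (x0 \in r).
  rewrite (bigD1_seq x0) //= big1_seq ?addn0 // => x /andP[xx0 xr'].
  exact: F0.
rewrite big1_seq // => x /andP[_ xr']; apply: F0 => //.
by apply: contraNneq xr => <-.
Qed.

Lemma sum_runs_excluded_le s A B m : (sum_runs (excluded_step s) A B m <= A * B)%N.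
Proof.
have [[a0 [b0 [a00 ex0]]]|nex] := pselect (exists a b, (0 < a)%N /\ excluded_step s a b).
  apply: (@leq_sum_unique _ _ a0); first exact: iota_uniq.
    move=> a; rewrite mem_index_iota => /andP[a1 _] aa0; rewrite big1 // => b ex.
    have [e _] := excluded_step_inj a1 a00 ex ex0.
    by rewrite e eqxx in aa0.
  rewrite big_mkcond; apply: (@leq_sum_unique _ _ b0); first exact: iota_uniq.
    move=> b _ bb0; case: ifP => // ex.
    have [_ e] := excluded_step_inj a00 a00 ex ex0.
    by rewrite e eqxx in bb0.
  by case: ifP => // _; exact: runs_le.
rewrite /sum_runs big1_seq // => a /andP[_]; rewrite mem_index_iota => /andP[a1 _].
by rewrite big1 // => b ex; case: nex; exists a, b.
Qed.

Lemma convex_sum_runs (P : nat -> nat -> bool) A B :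
  convex_seq (fun k => (sum_runs P A B k)%:R : R).
Proof. by move=> k; rewrite -natrM -natrD ler_nat sum_runs_convex. Qed.

(** By convexity the left side is at most E(0) - E(m), and E(0) <= A B. *)
Lemma excluded_decrement s A B m (E := sum_runs (excluded_step s) A B) :
  m%:R * ((E m)%:R - (E m.+1)%:R) <= A%:R * B%:R :> R.
Proof.
have /andP[+ _] := convex_seq_sub 0 m (convex_sum_runs (excluded_step s) A B).
rewrite add0n -/E => /le_trans; apply; rewrite lerBlDr -natrM -natrD ler_nat.
by rewrite (leq_trans (sum_runs_excluded_le s A B 0)) // leq_addr.
Qed.

(* The excluded slope is that of at most one primitive step, which contributes
   O(A B / m) lines and O(A B) incidences: negligible when m is small against A
   and B. *)
Lemma box_asymptotics e : 0 < e -> exists M : nat, exists2 kappa : R, 0 < kappa &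
  forall A B m s, (0 < m)%N -> (M <= m)%N -> m%:R <= kappa * A%:R -> m%:R <= kappa * B%:R ->
  `|(num_elts (rich A B s m.+1))%:R * m%:R ^+ 3 / (A%:R * B%:R) ^+ 2 - (@pi R ^+ 2 / 6)^-1| <= e
  /\ `|(incidences (@box R A B) (rich A B s m.+1))%:R * m%:R ^+ 2 / (A%:R * B%:R) ^+ 2
       - 3 / 2 * (@pi R ^+ 2 / 6)^-1| <= e.
Proof.
move=> e0; have e2 : 0 < e / 2 by rewrite divr_gt0.
have [k1 k10 H1] := run_density_limit e2.
have [M [k2 k20 H2]] := run_decrement_limit e2.
pose kappa := Num.min (Num.min k1 k2) (Num.min 1 (e / 16)).
have kap0 : 0 < kappa by rewrite !lt_min k10 k20 ltr01 divr_gt0.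
have [kk1 kk2 kk3 kk4] : [/\ kappa <= k1, kappa <= k2, kappa <= 1 & kappa <= e / 16].
  by rewrite /kappa !ge_min !lexx !orbT.
clearbody kappa; exists M, kappa => // A B m s m0 Mm mA mB.
have m0' : (0 : R) < m%:R by rewrite ltr0n.
have A0 : (0 : R) < A%:R by rewrite -(pmulr_rgt0 _ kap0) (lt_le_trans m0').
have B0 : (0 : R) < B%:R by rewrite -(pmulr_rgt0 _ kap0) (lt_le_trans m0').
have {H1} := H1 A B m m0 (le_trans mA (ler_wpM2r (ltW A0) kk1))
  (le_trans mB (ler_wpM2r (ltW B0) kk1)).
have {H2} := H2 A B m Mm (le_trans mA (ler_wpM2r (ltW A0) kk2))
  (le_trans mB (ler_wpM2r (ltW B0) kk2)).
rewrite num_rich // incidences_rich // /run_density !natrM natrD natrM.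
rewrite natrB ?leq_sum_runs // !(sum_runs_split s) !natrD.
have /= := @excluded_decrement s A B m; have := sum_runs_excluded_le s A B m.
have := leq_sum_runs (excluded_step s) A B m.
rewrite -!(ler_nat R) natrM -(natr1 m).
have : 0 <= (sum_runs (excluded_step s) A B m)%:R :> R by [].
move: (sum_runs (primitive_step s) A B m)%:R (sum_runs (primitive_step s) A B m.+1)%:R.
move: (sum_runs (excluded_step s) A B m)%:R (sum_runs (excluded_step s) A B m.+1)%:R.
move: (@pi R ^+ 2 / 6)^-1 => w E E' S S' E0 EE' EN dE.
set N := A%:R * B%:R in EN dE *; have N0 : 0 < N by rewrite mulr_gt0.
have tN : m%:R ^+ 2 / N <= e / 16.
  rewrite ler_pdivrMr //; apply: (@le_trans _ _ (kappa ^+ 2 * N)).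
    rewrite /N (_ : kappa ^+ 2 * _ = (kappa * A%:R) * (kappa * B%:R)); last by ring.
    by rewrite expr2 ler_pM // ltW.
  by rewrite ler_pM2r // (le_trans _ kk4) // expr2 ler_piMl // ltW.
(* Applied to E and to m (E - E'), the two contributions of the excluded slope. *)
have small x : 0 <= x -> x <= N -> 0 <= m%:R ^+ 2 * x / N ^+ 2 <= e / 16.
  move=> x0 xN; rewrite divr_ge0 ?mulr_ge0 ?exprn_ge0 ?(ltW N0) //=.
  apply: le_trans tN; rewrite ler_pdivrMr ?exprn_gt0 //.
  rewrite (_ : m%:R ^+ 2 / N * N ^+ 2 = m%:R ^+ 2 * N); last first.
    by field; rewrite gt_eqF.
  by rewrite ler_wpM2l ?exprn_ge0.
have /andP[v0 v1] := small E E0 EN.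
have uE : 0 <= m%:R * (E - E') by rewrite mulr_ge0 // subr_ge0.
have /andP[u0 u1] := small _ uE dE.
clearbody N; rewrite !ler_norml => /andP[p1 p2] /andP[q1 q2].
(* S + E is the full coprime sum. Lines receive half of the decrement limit 2w; incidences receive
   in addition half of the density limit w, whence 3w/2. *)
have XE : 2 * (S - S') * m%:R ^+ 3 / N ^+ 2 =
    1 / 2 * (4 * m%:R ^+ 3 * (S + E - (S' + E')) / N ^+ 2)
    - 2 * (m%:R ^+ 2 * (m%:R * (E - E')) / N ^+ 2).
  by field; rewrite gt_eqF.
have YE : 2 * ((m%:R + 1) * (S - S') + S') * m%:R ^+ 2 / N ^+ 2 =
    2 * (S - S') * m%:R ^+ 3 / N ^+ 2 + 1 / 2 * (4 * m%:R ^+ 2 * (S + E) / N ^+ 2)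
    - 2 * (m%:R ^+ 2 * E / N ^+ 2).
  by field; rewrite gt_eqF.
rewrite YE XE; move: p1 p2 q1 q2 u0 u1 v0 v1.
move: (4 * m%:R ^+ 3 * (S + E - (S' + E')) / N ^+ 2) (4 * m%:R ^+ 2 * (S + E) / N ^+ 2).
move: (m%:R ^+ 2 * (m%:R * (E - E')) / N ^+ 2) (m%:R ^+ 2 * E / N ^+ 2) => U V P Q.
by move=> *; split; apply/andP; split; lra.
Qed.

(** eps n^alpha -> oo makes m large, eps -> 0 makes m small against n^alpha, and alpha <= 1/2 gives
    n^alpha <= n^(1 - alpha). *)
Lemma grid_regime alpha (eps : nat -> R) (kappa : R) (M : nat) :
  1 / 3 <= alpha <= 1 / 2 -> (forall n : nat, (0 < n)%N -> 0 < eps n < 1) ->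
  eps n @[n --> \oo] --> (0 : R) -> eps n * n%:R `^ alpha @[n --> \oo] --> +oo ->
  0 < kappa -> \forall n \near \oo, 1 < eps n * n%:R `^ alpha /\
    forall m : nat, m%:R < eps n * n%:R `^ alpha <= m.+1%:R ->
      [/\ (M <= m)%N, m%:R <= kappa * (Num.truncn (n%:R `^ alpha))%:R &
          m%:R <= kappa * (Num.truncn (n%:R `^ (1 - alpha)))%:R].
Proof.
move=> /andP[_ al2] heps eps0 epsoo kap0.
have kap2 : 0 < kappa / 2 by rewrite divr_gt0.
near=> n.
have n0 : (0 < n)%N by near: n; exists 1%N.
have /andP[e0 e1] := heps n n0.
have ek : eps n <= kappa / 2.
  rewrite ltW //; near: n; move/cvgrPdist_lt: eps0 => /(_ _ kap2).
  by apply: filterS => n; rewrite sub0r normrN => /(le_lt_trans (ler_norm _)).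
have big : M%:R + 2 <= eps n * n%:R `^ alpha.
  by near: n; move/cvgryPge: epsoo; apply.
have M0 : 0 <= M%:R :> R by [].
split; first by lra.
move=> m /andP[mx xm]; set x := n%:R `^ alpha in big mx xm *.
have x0 : 0 <= x by exact: powR_ge0.
have x2 : 2 <= x by nra.
(* Truncation costs at most a factor 2, which kappa / 2 in [ek] compensates. *)
have xA : x <= 2 * (Num.truncn x)%:R.
  have := truncnS_gt x; rewrite -natr1.
  have : (1 <= Num.truncn x)%N by rewrite truncn_gt0; lra.
  by rewrite -(ler_nat R); move: (Num.truncn x)%:R => t; lra.
have mA : m%:R <= kappa * (Num.truncn x)%:R.
  rewrite (le_trans (ltW mx)) // (le_trans (ler_wpM2r x0 ek)) //.
  by rewrite mulrAC -mulrA ler_pM2l // ler_pdivrMr // mulrC.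
split=> //.
  have : M%:R + 2 <= m%:R + 1 :> R by rewrite natr1; lra.
  by move=> h; rewrite -(ler_nat R); lra.
apply: (le_trans mA); rewrite ler_pM2l // ler_nat le_truncn // ler_powR ?ler1n //.
by lra.
Unshelve. all: by end_near.
Qed.

Lemma cvg_powR (f : nat -> R) (l p : R) : 0 < l ->
  f n @[n --> \oo] --> l -> f n `^ p @[n --> \oo] --> l `^ p.
Proof.
move=> l0 fl; have cont : {for l, continuous (@powR R ^~ p)}.
  apply: differentiable_continuous; apply/derivable1_diffP.
  by apply: derivable_powR; rewrite in_itv /= l0.
exact: cvg_comp fl cont.
Qed.

(** The powers of t cancel since (t^3)^(2/3) = t^2, and N^-2 over N^(-4/3) leaves N^(-2/3). *)
Lemma ratio_powR (t N L I : R) : 0 < t -> 0 < N -> 0 < L ->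
  I / (N `^ (2 / 3) * L `^ (2 / 3)) =
  (I * t ^+ 2 / N ^+ 2) / (L * t ^+ 3 / N ^+ 2) `^ (2 / 3).
Proof.
move=> t0 N0 L0.
have p3 (x : R) : 0 < x -> (x ^+ 3) `^ (2 / 3) = x ^+ 2.
  move=> x0; rewrite -powR_mulrn ?(ltW x0) // -powRrM -powR_mulrn ?(ltW x0) //.
  by congr (_ `^ _); field.
have -> : L * t ^+ 3 / N ^+ 2 = (N * L) * (t / N) ^+ 3 by field; rewrite gt_eqF.
have tN : 0 < t / N by rewrite divr_gt0.
rewrite (powRM _ (ltW (mulr_gt0 N0 L0)) (ltW (exprn_gt0 3 tN))).
rewrite (powRM _ (ltW N0) (ltW L0)) p3 //.
by field; rewrite !gt_eqF ?powR_gt0.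
Qed.

Lemma powR_cbrtK x : 0 <= x -> (x `^ (1 / 3)) ^+ 3 = x.
Proof.
move=> x0; rewrite -powR_mulrn ?powR_ge0 // -powRrM.
by rewrite (_ : 1 / 3 * 3%:R = 1) ?powRr1 //; field.
Qed.

(** With w = 6/pi^2 both sides are (3/2) w^(1/3), as 3/(4 pi^2) = w/8. *)
Lemma constantE : 3 / 2 * (@pi R ^+ 2 / 6)^-1 / (@pi R ^+ 2 / 6)^-1 `^ (2 / 3) =
  3 * (3 / (4 * pi ^+ 2)) `^ (1 / 3).
Proof.
have /andP[w0 _] := inv_pi2_bounds R.
have -> : 3 / (4 * @pi R ^+ 2) = (1 / 2) ^+ 3 * (pi ^+ 2 / 6)^-1.
  have := @pi_gt0 R; move: (@pi R) => p p0; field.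
  by rewrite gt_eqF.
move: (pi ^+ 2 / 6)^-1 w0 => w w0.
rewrite -mulrA (_ : w / w `^ (2 / 3) = w `^ (1 / 3)); last first.
  rewrite -{1}[w]powRr1 ?ltW // -powRB ?(gt_eqF w0) ?implybT //.
  by congr (_ `^ _); field.
rewrite powRM ?exprn_ge0 ?(ltW w0) ?divr_ge0 // -powR_mulrn ?divr_ge0 // -powRrM.
by rewrite (_ : 3%:R * (1 / 3) = 1) ?powRr1 ?divr_ge0 //; [ring|field].
Qed.

Lemma constant_approx : `|3 * (3 / (4 * @pi R ^+ 2)) `^ (1 / 3) - 127 / 100| < 1 / 200.
Proof.
set c := 3 * _; have pi0 := @pi_gt0 R.
have c0 : 0 < c by rewrite mulr_gt0 // powR_gt0 // divr_gt0 // mulr_gt0 // exprn_gt0.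
have c3 : c ^+ 3 * (pi ^+ 2 / 6) = 27 / 8.
  rewrite /c exprMn powR_cbrtK; last first.
    by rewrite divr_ge0 // mulr_ge0 // exprn_ge0 // ltW.
  by move: (@pi R) pi0 => p p0; field; rewrite gt_eqF.
have [z1 z2] : 163 / 100 < @pi R ^+ 2 / 6 /\ @pi R ^+ 2 / 6 < 166 / 100.
  (* Six terms place pi^2/6 between 1.63 and 1.66, enough for c^3 = (27/8) / (pi^2/6) to confine c
     to within 1/200 of 1.27. *)
  have /andP[] := @basel_bounds R 6 isT.
  rewrite !inv_sqr_sumS (_ : inv_sqr_sum R 0 = 0) ?/inv_sqr_sum ?big_geq //.
  rewrite (_ : 0 + _ + _ + _ + _ + _ + _ = 5369 / 3600); last by field.
  by move: (@pi R ^+ 2 / 6) => z h1 h2; split; lra.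
move: (@pi R ^+ 2 / 6) c c0 c3 z1 z2 => z c c0 c3 z1 z2.
rewrite ltr_norml; apply/andP; split.
  rewrite ltrBrDr ltNge; apply/negP => h.
  have : c ^+ 3 <= (127 / 100 - 1 / 200) ^+ 3.
    by rewrite lerXn2r ?nnegrE //; lra.
  by move=> h3; nra.
rewrite ltrBlDr ltNge; apply/negP => h.
have : (127 / 100 + 1 / 200) ^+ 3 <= c ^+ 3.
  by rewrite lerXn2r ?nnegrE //; lra.
by move=> h3; nra.
Qed.

End Asymptotics.

(** * Passage to the limit in n *)

Theorem theorem1p2 (R : realType) (alpha : R) (eps : nat -> R)
    (halpha : 1 / 3 <= alpha <= 1 / 2)
    (heps : forall n : nat, (0 < n)%N -> 0 < eps n < 1)
    (heps0 : eps n @[n --> \oo] --> (0 : R))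
    (hepsoo : eps n * n%:R `^ alpha @[n --> \oo] --> +oo)
    (hLo : little_o (R := R)
       (fun n => (num_elts (rich_lines alpha (eps n) n))%:R)
       (fun n => (num_elts (grid alpha n))%:R ^+ 2))
    (hLomega : little_omega (R := R)
       (fun n => (num_elts (rich_lines alpha (eps n) n))%:R)
       (fun n => (num_elts (grid alpha n))%:R `^ (2 - 3 * alpha))) :
  let c : R := 3 * (3 / (4 * pi ^+ 2)) `^ (1 / 3) in
  (exists2 d : nat -> R, d n @[n --> \oo] --> (0 : R) &
     \forall n \near \oo,
       (incidences (grid alpha n) (rich_lines alpha (eps n) n))%:R =
       (c + d n) * (num_elts (grid alpha n))%:R `^ (2 / 3)
                 * (num_elts (rich_lines alpha (eps n) n))%:R `^ (2 / 3))
  /\ `|c - 127 / 100| < 1 / 200.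
Proof.
move=> c; split; last exact: constant_approx.
pose N n : R := (num_elts (grid alpha n))%:R.
pose L n : R := (num_elts (rich_lines alpha (eps n) n))%:R.
pose I n : R := (incidences (grid alpha n) (rich_lines alpha (eps n) n))%:R.
(* m(n) is the ceiling of eps n^alpha minus 1; where eps n^alpha <= 1 nothing is required of it and
   0 serves. *)
have [m mP] : {m : nat -> nat & forall n, 1 < eps n * n%:R `^ alpha ->
    (0 < m n)%N /\ (m n)%:R < eps n * n%:R `^ alpha <= (m n).+1%:R}.
  apply: (@choice _ _ (fun n k => 1 < eps n * n%:R `^ alpha ->
    (0 < k)%N /\ k%:R < eps n * n%:R `^ alpha <= k.+1%:R)) => n.
  case: (ltP 1 (eps n * n%:R `^ alpha)) => [/pred_ceil[k]|_].
    by exists k.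
  by exists 0%N.
pose X n := L n * (m n)%:R ^+ 3 / N n ^+ 2.
pose Y n := I n * (m n)%:R ^+ 2 / N n ^+ 2.
pose w := (@pi R ^+ 2 / 6)^-1; have /andP[w0 _] := inv_pi2_bounds R.
have XY (e : R) : 0 < e -> \forall n \near \oo,
    [/\ `|w - X n| <= e, `|3 / 2 * w - Y n| <= e & (0 < m n)%N].
  move=> e0; have [M [kappa kap0 H]] := box_asymptotics e0.
  apply: filterS (grid_regime M halpha heps heps0 hepsoo kap0) => n [x1 G].
  have [m0 mx] := mP n x1; have [g1 g2 g3] := G _ mx.
  have [hX hY] := H _ _ _ (n%:R `^ (1 - 2 * alpha)) m0 g1 g2 g3.
  split=> //; rewrite distrC /X /Y /L /I /N (rich_lines_rich mx) grid_box num_box natrM.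
    exact: hX.
  exact: hY.
have Xw : X n @[n --> \oo] --> w.
  by apply/cvgrPdist_le => e /XY; apply: filterS => n [].
have Yw : Y n @[n --> \oo] --> 3 / 2 * w.
  by apply/cvgrPdist_le => e /XY; apply: filterS => n [].
have Zc : Y n / X n `^ (2 / 3) @[n --> \oo] --> c.
  rewrite /c -constantE; apply: cvgM => //; apply: cvgV; last exact: cvg_powR.
  by rewrite gt_eqF // powR_gt0.
(* The error is the exact deviation from c, so only the identity of [ratio_powR] remains, valid once
   N, L and m are positive. *)
exists (fun n => Y n / X n `^ (2 / 3) - c).
  by rewrite -(subrr c); apply: cvgB => //; exact: cvg_cst.
have X0 : \forall n \near \oo, 0 < X n by exact: cvgr_gt w0.
apply: filterS2 X0 (XY 1 ltr01) => n Xn [_ _ m0].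
(* Were N n or L n zero, X n would be 0, division by 0 being 0. *)
have N0 : 0 < N n.
  by rewrite lt_def ler0n andbT; apply: contraTneq Xn => Nn;
    rewrite /X Nn expr0n /= invr0 mulr0 ltxx.
have L0 : 0 < L n.
  by rewrite lt_def ler0n andbT; apply: contraTneq Xn => Ln; rewrite /X Ln !mul0r ltxx.
have m0' : (0 : R) < (m n)%:R by rewrite ltr0n.
rewrite [c + _]addrC subrK /X /Y -ratio_powR // -mulrA divfK //.
by rewrite mulf_neq0 // gt_eqF // powR_gt0.
Qed.
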